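(* Let $(\varepsilon_i)_{i\in\mathbb{Z}}$ be i.i.d. real random variables with $\mathbb{E}\varepsilon_i=0$, $\mathbb{E}\varepsilon_i^2=1$, and let $X_n=\sum_{i=0}^\infty a_i\varepsilon_{n-i}$ with $\sum_{i=0}^\infty|a_i|<\infty$. Let $K:\mathbb{R}\to\mathbb{R}$ be any measurable transformation with $\mathbb{E}K^2(X_n)<\infty$ such that $$\|K_{n-1}(X_{n,1})-K_{n-1}(X_{n,0})\|=\mathcal{O}(|a_{n-1}|).$$ Then $K(X_n)$ has short memory in the covariance sense.
   Context: For a random variable $X$, $\|X\|=[\mathbb{E}(X^2)]^{1/2}$. Let $\mathcal{F}_i$ be generated by $(\ldots,\varepsilon_{i-1},\varepsilon_i)$, $X_{n,j}=\mathbb{E}(X_n\mid\mathcal{F}_j)$, and $K_n(w)=\mathbb{E}[K(w+X_n-X_{n,0})]$. The notation $u_n=\mathcal{O}(v_n)$ means that $u_n/v_n$ is bounded, i.e. $|u_n|\le Cv_n$ for a constant $C$. A (covariance) stationary time series $(W_n)_{n\in\mathbb{N}}$ has short memory in the covariance sense if $\sum_{n=1}^\infty|\mathrm{Cov}(W_1,W_n)|<\infty$. *)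

(* Defs.v *)
From HB Require Import structures.
From mathcomp Require Import all_boot all_order all_algebra finmap.
From mathcomp Require Import all_classical all_reals all_analysis.

Set Implicit Arguments.
Unset Strict Implicit.
Unset Printing Implicit Defensive.

Import Order.TTheory GRing.Theory Num.Theory.
Import numFieldNormedType.Exports.

Local Open Scope classical_set_scope.
Local Open Scope ring_scope.
Local Open Scope ereal_scope.

Definition mutually_independent d (T : measurableType d) (R : realType)
    (P : probability T R) (I : choiceType) (X : I -> T -> R) : Prop :=
  forall (J : {fset I}) (B : I -> set R), (forall i, measurable (B i)) ->
    P (\bigcap_(i in [set` J]) (X i @^-1` B i)) =
    \prod_(i <- J) P (X i @^-1` B i).

Definition identically_distributed d (T : measurableType d) (R : realType)
    (P : probability T R) (I : Type) (X : I -> T -> R) : Prop :=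
  forall (i j : I) (B : set R), measurable B ->
    P (X i @^-1` B) = P (X j @^-1` B).

(* F_j, the sigma-algebra generated by all eps_i with i <= j. *)
Definition past_sigma_algebra (T : Type) (R : realType) (eps : int -> T -> R)
    (j : int) : set (set T) :=
  <<s [set A | exists i : int, (i <= j)%R /\
               exists B : set R, measurable B /\ A = eps i @^-1` B] >>.

(* Y is a version of E(X | G). *)
Definition is_cond_expectation d (T : measurableType d) (R : realType)
    (P : probability T R) (G : set (set T)) (X Y : T -> R) : Prop :=
  [/\ forall B : set R, measurable B -> G (Y @^-1` B),
      P.-integrable setT (EFin \o Y) &
      forall A, G A -> \int[P]_(t in A) (Y t)%:E = \int[P]_(t in A) (X t)%:E].

(* K_n(w) = E[K(w + X_n - X_{n,0})], with Xc n j for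
   X_{n,j} = E(X_n | F_j). The integrand need not be integrable for every w;
   the value is kept in \bar R (with the convention +oo - oo = -oo where the
   expectation does not exist). *)
Definition smoothed_transform d (T : measurableType d) (R : realType)
    (P : probability T R) (K : R -> R) (X : nat -> T -> R)
    (Xc : nat -> int -> T -> R) (n : nat) (w : R) : \bar R :=
  'E_P[fun t => K (w + X n t - Xc n 0%R t)%R].

(* u_n = O(v_n) over n >= 1, as a bound valid for all n. *)
Definition bounded_ratio (R : realType) (u : nat -> \bar R) (v : nat -> R)
    : Prop :=
  exists C : R, forall n, (1 <= n)%N -> `|u n| <= (C * v n)%:E.

Definition covariance_stationary d (T : measurableType d) (R : realType)
    (P : probability T R) (W : nat -> T -> R) : Prop :=
  [/\ forall n, measurable_fun setT (W n),
      forall n, 'E_P[fun t => (W n t ^+ 2)%R] < +oo,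
      forall m n, 'E_P[W m] = 'E_P[W n] &
      forall m n h, covariance P (W m) (W (m + h)%N) =
                    covariance P (W n) (W (n + h)%N)].

Definition short_memory d (T : measurableType d) (R : realType)
    (P : probability T R) (W : nat -> T -> R) : Prop :=
  covariance_stationary P W /\
  \sum_(1 <= n <oo) `|covariance P (W 1%N) (W n)| < +oo.

(* Main.v *)
Require Import Defs.
From HB Require Import structures.
From mathcomp Require Import all_boot all_order all_algebra finmap.
From mathcomp Require Import all_classical all_reals all_analysis.
From mathcomp Require Import measurable_realfun simple_functions zify.

Set Implicit Arguments.
Unset Strict Implicit.
Unset Printing Implicit Defensive.

Import Order.TTheory GRing.Theory Num.Theory.
Import numFieldNormedType.Exports.

Local Open Scope classical_set_scope.
Local Open Scope ring_scope.
Local Open Scope ereal_scope.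

(** Write F_j for the sigma-algebra of the innovations eps_i with i <= j and
    X_{n,j} = E(X_n | F_j), the part of the series of X_n that involves the
    innovations up to time j.  The remainder X_n - X_{n,n-m} is a sum of m
    innovations that are independent of F_{n-m}, so the conditional
    expectation of K(X_n) is computed by freezing the past and averaging over
    the remainder:
      E(K(X_n) | F_{n-m}) = K_m(X_{n,n-m}).
    This random variable is [condK n m], and [condK_spec] is its
    characterization.  Replacing X_{n,n-m} by X_{n,n-m-1} in the same formula
    gives [frozenK n m], which is already F_{n-m-1}-measurable.  By
    stationarity the norm of [condK n m - frozenK n m] depends on m only, and
    for n = m + 1 the hypothesis on K bounds it by C |a_m|.

    For fixed n, [condK n m] is a martingale with time running backwards as m
    grows.  As E(. | F_{n-m-1}) is an orthogonal projection, its increment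
    [condK n m - condK n m.+1] is no longer than
    [condK n m - frozenK n m], hence is bounded by C |a_m|
    ([condK_diff_l2norm]).  Increments at distinct times being orthogonal,
      E[K(X_1) K(X_{h+1})] - E K(X_1) E K(X_{h+1})
    is the sum over k >= 0 of the inner products of the increments of the two
    martingales over the same step of time, and is therefore at most
    C^2 sum_k |a_k| |a_{h+k}| in absolute value ([condK_ip_step]).  Summing
    over h gives C^2 (sum_k |a_k|)^2, which is finite ([telescoping_bound]).

    That the telescoping sum exhausts the covariance means that
    E(K(X_1) | F_j) becomes uncorrelated with K(X_{h+1}) as j tends to -oo.
    This is the triviality of the remote past of an independent family, in
    the weak form [mixing]: a random variable that depends on the far past
    only is asymptotically uncorrelated with every fixed square-integrable
    function of the family.

    Stationarity is handled by writing everything as a function of the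
    sequence (eps_n, eps_{n-1}, ...), called [innovations n], whose law does
    not depend on n ([innovations_law]): X_{n,n-m} is its [tail_sum] and
    X_n - X_{n,n-m} its [head_sum]. *)

(** * Square-integrable random variables *)

Section square_integrable.
Context d (T : measurableType d) (R : realType) (P : probability T R).
Local Open Scope ring_scope.

Lemma sqr_poweR (x : R) : (`|x%:E| `^ 2%R)%E = (x ^+ 2)%:E.
Proof.
by rewrite abse_EFin poweR_EFin powR_mulrn ?normr_ge0// real_normK ?num_real.
Qed.

Lemma Lfun2P (f : T -> R) : measurable_fun setT f ->
  (\int[P]_t (f t ^+ 2)%:E < +oo)%E <-> f \in Lfun P 2%:E.
Proof.
move=> mf; split=> [fin|/Lfun2_integrable_sqr/integrableP[_]]; last first.
  by under eq_integral do rewrite /= ger0_norm ?sqr_ge0//.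
apply/andP; split; rewrite inE //=.
rewrite /finite_norm unlock poweR_lty//.
by under eq_integral do rewrite sqr_poweR.
Qed.

Definition l2norm (f : T -> R) : R := Num.sqrt (\int[P]_t (f t ^+ 2)).

Lemma l2norm_ge0 f : 0 <= l2norm f. Proof. exact: sqrtr_ge0. Qed.

Lemma Lnorm2_EFin (f : T -> R) : f \in Lfun P 2%:E ->
  'N[P]_2%:E[EFin \o f]%E = (l2norm f)%:E.
Proof.
move=> Lf; rewrite unlock.
under eq_integral do rewrite sqr_poweR.
have /(integrable_fin_num measurableT) fi := Lfun2_integrable_sqr Lf.
rewrite /= in fi.
rewrite -(fineK fi) poweR_EFin /l2norm /Rintegral powR12_sqrt//.
by rewrite fine_ge0// integral_ge0// => t _; rewrite lee_fin sqr_ge0.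
Qed.

Lemma cauchy_schwarz (f g : T -> R) : f \in Lfun P 2%:E -> g \in Lfun P 2%:E ->
  `|\int[P]_t (f t * g t)| <= l2norm f * l2norm g.
Proof.
move=> Lf Lg; have /Lfun1_integrable ifg := Lfun2_mul_Lfun1 Lf Lg.
rewrite -lee_fin EFinM -!Lnorm2_EFin//.
have mf : measurable_fun setT f by move: Lf => /andP[]; rewrite inE.
have mg : measurable_fun setT g by move: Lg => /andP[]; rewrite inE.
have h22 : 2^-1 + 2^-1 = 1 :> R by rewrite [RHS]splitr !div1r.
apply: (le_trans _ (hoelder P mf mg _ _ h22)) => //.
rewrite Lnorm1 /Rintegral -abse_EFin fineK ?integrable_fin_num//.
by apply: le_abse_integral => //; case/integrableP: ifg.
Qed.

Lemma mul_integrable (f g : T -> R) : f \in Lfun P 2%:E -> g \in Lfun P 2%:E ->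
  P.-integrable setT (EFin \o (fun t => f t * g t)).
Proof. by move=> Lf Lg; apply/Lfun1_integrable/Lfun2_mul_Lfun1. Qed.

Lemma Lfun2_integrable (f : T -> R) : f \in Lfun P 2%:E ->
  P.-integrable setT (EFin \o f).
Proof.
move=> Lf; apply/Lfun1_integrable; apply: (Lfun_subset12 _ Lf).
by rewrite fin_num_measure.
Qed.

End square_integrable.

Section square_integrable_algebra.
Context d (T : measurableType d) (R : realType) (P : probability T R).
Local Open Scope ring_scope.

Lemma Lfun_meas p (f : T -> R) : f \in Lfun P p -> measurable_fun setT f.
Proof. by move=> /andP[]; rewrite inE. Qed.

Lemma Lfun2_dom (f g : T -> R) : measurable_fun setT f ->
  (forall t, `|f t| <= `|g t|) -> g \in Lfun P 2%:E -> f \in Lfun P 2%:E.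
Proof.
move=> mf fg Lg; apply/Lfun2P => //.
apply: (le_lt_trans _ ((Lfun2P P (Lfun_meas Lg)).2 Lg)).
apply: ge0_le_integral => //.
- by move=> t _; rewrite lee_fin sqr_ge0.
- by apply/measurable_EFinP; exact: measurable_funX.
- by apply/measurable_EFinP; apply: measurable_funX; exact: Lfun_meas Lg.
- move=> t _; rewrite lee_fin -[leLHS]real_normK ?num_real//.
  by rewrite -[leRHS]real_normK ?num_real// lerXn2r ?nnegrE.
Qed.

Lemma Lfun2_bounded (f : T -> R) (c : R) : measurable_fun setT f ->
  (forall t, `|f t| <= `|c|) -> f \in Lfun P 2%:E.
Proof. by move=> mf fc; apply: Lfun2_dom (Lfun_cst P c 2). Qed.

Lemma Lfun2D (f g : T -> R) : f \in Lfun P 2%:E -> g \in Lfun P 2%:E ->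
  (fun t => f t + g t) \in Lfun P 2%:E.
Proof. by have [_ LD] := Lfun_addr_closed P (lee1n (R:=R) 2); exact: LD. Qed.

Lemma Lfun2B (f g : T -> R) : f \in Lfun P 2%:E -> g \in Lfun P 2%:E ->
  (fun t => f t - g t) \in Lfun P 2%:E.
Proof. by move=> Lf /Lfun_oppr_closed; exact: Lfun2D. Qed.

Lemma Lfun2Z (a : R) (f : T -> R) : f \in Lfun P 2%:E ->
  (fun t => a * f t) \in Lfun P 2%:E.
Proof.
move=> Lf; under eq_fun do rewrite mulrC.
by apply: Lfun_scale; rewrite ?ler1n.
Qed.

Lemma indic_Lfun2 (A : set T) : measurable A ->
  (\1_A : T -> R) \in Lfun P 2%:E.
Proof.
move=> mA; apply: (@Lfun2_bounded _ 1); first exact: measurable_indic.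
by move=> t; rewrite indicE normr1; case: (_ \in _); rewrite ?normr1 ?normr0.
Qed.

(** Dominated convergence in the quadratic mean, in the form that the density
    arguments below use. *)
Lemma l2_dominated (Z_ : nat -> T -> R) (Z G : T -> R) (e : R) :
  (forall n, measurable_fun setT (Z_ n)) -> measurable_fun setT Z ->
  G \in Lfun P 2%:E -> (forall n t, `|Z_ n t| <= `|G t|) ->
  (forall t, Z_ ^~ t @ \oo --> Z t) -> 0 < e ->
  exists n, l2norm P (fun t => Z t - Z_ n t) <= e.
Proof.
move=> mZn mZ LG ZG Zc e0.
have ZG' t : `|Z t| <= `|G t|.
  have /cvg_norm cZ := Zc t.
  rewrite -(cvg_lim (@Rhausdorff R) cZ).
  by apply: limr_le; [exact: cvgP cZ|near=> n; exact: ZG].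
have mS n : measurable_fun setT (fun t => ((Z t - Z_ n t) ^+ 2)%:E).
  by apply/measurable_EFinP; apply: measurable_funX; exact: measurable_funB.
have iG : P.-integrable setT (fun t => (4 * (G t ^+ 2))%:E).
  have := Lfun2_integrable_sqr LG => /(integrableZl measurableT 4).
  by apply: eq_integrable.
(* Z - Z_ n is at most twice the dominating function *)
have bound n t : (`|((Z t - Z_ n t) ^+ 2)%:E| <= (4 * G t ^+ 2)%:E)%E.
  rewrite /= lee_fin ger0_norm ?sqr_ge0// -[leLHS]real_normK ?num_real//.
  have -> : 4 * G t ^+ 2 = (`|G t| + `|G t|) ^+ 2.
    rewrite -mulr2n -[_ *+ 2]mulr_natr exprMn real_normK ?num_real//.
    by rewrite mulrC -natrX.
  rewrite lerXn2r ?nnegrE// ?addr_ge0//.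
  by rewrite (le_trans (ler_normB _ _))// lerD.
have := @dominated_cvg _ _ _ P setT measurableT _ (fun=> 0%E) _ mS _ _ iG _.
rewrite integral0 => cv.
have {cv} : (\int[P]_t ((Z t - Z_ n t) ^+ 2)%:E)%E @[n --> \oo] --> 0%E.
  apply: cv => // t _.
  apply: cvg_EFin; first exact: nearW.
  have c : Z t - Z_ n t @[n --> \oo] --> 0.
    by rewrite -(subrr (Z t)); apply: cvgB; [exact: cvg_cst|exact: Zc].
  have := cvgM c c; rewrite mulr0; exact.
move=> /fine_cvgP[_ /cvgr0Pnorm_le/(_ _ (exprn_gt0 2 e0)) [N _ /(_ N)]] /=.
move=> /(_ (leqnn N)) h; exists N.
rewrite /l2norm -[leRHS]ger0_norm ?(ltW e0)// -sqrtr_sqr.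
by apply: ler_wsqrtr; apply: le_trans (ler_norm _) h.
Unshelve. all: by end_near. Qed.

Lemma l2_ipBl (f f' g : T -> R) : f \in Lfun P 2%:E -> f' \in Lfun P 2%:E ->
  g \in Lfun P 2%:E ->
  \int[P]_t ((f t - f' t) * g t) =
  \int[P]_t (f t * g t) - \int[P]_t (f' t * g t).
Proof.
move=> Lf Lf' Lg; rewrite -RintegralB//; try exact: mul_integrable.
by apply: eq_Rintegral => t _; rewrite mulrBl.
Qed.

Lemma l2_ipC (f g : T -> R) :
  \int[P]_t (f t * g t) = \int[P]_t (g t * f t).
Proof. by apply: eq_Rintegral => t _; rewrite mulrC. Qed.

Lemma l2_ipBr (f g g' : T -> R) : f \in Lfun P 2%:E -> g \in Lfun P 2%:E ->
  g' \in Lfun P 2%:E ->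
  \int[P]_t (f t * (g t - g' t)) =
  \int[P]_t (f t * g t) - \int[P]_t (f t * g' t).
Proof.
by move=> Lf Lg Lg'; rewrite l2_ipC l2_ipBl// (l2_ipC g) (l2_ipC g').
Qed.

(** An orthogonal projection shortens: if g - f is orthogonal to f then f is
    the projection of g on the line of f, and Cauchy-Schwarz concludes. *)
Lemma l2norm_le_of_ip (f g : T -> R) : f \in Lfun P 2%:E ->
  g \in Lfun P 2%:E ->
  \int[P]_t (f t * f t) = \int[P]_t (f t * g t) -> l2norm P f <= l2norm P g.
Proof.
move=> Lf Lg fg; have [->|f0] := eqVneq (l2norm P f) 0; first exact: l2norm_ge0.
have fp : 0 < l2norm P f by rewrite lt0r f0 l2norm_ge0.
rewrite -(ler_pM2l fp) (le_trans _ (cauchy_schwarz Lf Lg))// -fg.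
rewrite -expr2 sqr_sqrtr; last by apply: Rintegral_ge0 => t _; exact: sqr_ge0.
exact: ler_norm.
Qed.

End square_integrable_algebra.

(** * Changing random variables on null sets *)

Section ae_tools.
Context d (T : measurableType d) (R : realType) (P : probability T R).

Lemma integrable_ae_eq (f g : T -> \bar R) : measurable_fun setT g ->
  {ae P, forall t, f t = g t} -> P.-integrable setT f -> P.-integrable setT g.
Proof.
move=> mg fg /integrableP[mf fin]; apply/integrableP; split => //.
rewrite -(@ge0_ae_eq_integral _ _ _ _ _ (fun t => `|f t|))//.
- exact: measurableT_comp.
- exact: measurableT_comp.
- by apply: filterS fg => t + _ => ->.
Qed.

(** The integral is the difference of the integrals of the positive and of the
    negative part, and +oo - oo is -oo: it is finite only when both parts
    are. *)
Lemma integrable_of_integral_fin (f : T -> R) : measurable_fun setT f ->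
  \int[P]_t (f t)%:E \is a fin_num -> P.-integrable setT (EFin \o f).
Proof.
move=> mf; rewrite -integral_fin_num_abs// => fin.
by apply/integrableP; split => //; exact/measurable_EFinP.
Qed.

Lemma Rintegral_ae_eq (f g : T -> R) : measurable_fun setT f ->
  measurable_fun setT g -> {ae P, forall t, f t = g t} ->
  (\int[P]_t f t = \int[P]_t g t)%R.
Proof.
move=> mf mg fg; rewrite /Rintegral; congr fine; apply: ae_eq_integral => //.
- exact/measurable_EFinP.
- exact/measurable_EFinP.
- by apply: filterS fg => t /= + _ => ->.
Qed.

Lemma Lfun2_ae_eq (f g : T -> R) : measurable_fun setT g ->
  {ae P, forall t, f t = g t} -> f \in Lfun P 2%:E -> g \in Lfun P 2%:E.
Proof.
move=> mg fg Lf; apply/Lfun2P => //.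
have mf := Lfun_meas Lf.
rewrite -(@ge0_ae_eq_integral _ _ _ _ _ (fun t => (f t ^+ 2)%:E))//.
- exact/Lfun2P.
- by apply/measurable_EFinP; exact: measurable_funX.
- by apply/measurable_EFinP; exact: measurable_funX.
- by move=> t _; rewrite lee_fin sqr_ge0.
- by move=> t _; rewrite lee_fin sqr_ge0.
- by apply: filterS fg => t /= -> _.
Qed.

End ae_tools.

(** * Fubini for independent random elements *)

(** Change of variables that holds even where the integral does not exist: the
    positive and the negative part are transported separately. *)
Lemma integral_distributionT d d' (T : measurableType d)
    (T' : measurableType d') (R : realType) (P : probability T R)
    (X : {RV P >-> T'}) (f : T' -> \bar R) : measurable_fun setT f ->
  \int[distribution P X]_s f s = \int[P]_t f (X t).
Proof.
move=> mf; rewrite [LHS]integralE [RHS]integralE !ge0_integral_distribution//.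
- by congr (_ - _); apply: eq_integral => x _;
    rewrite ?funeposE ?funenegE /= ?funeposE ?funenegE.
- exact: measurable_funeneg.
- exact: measurable_funepos.
Qed.

(** Independence says that the law of the pair is the product of the laws, so
    Fubini on the product space can be read on the original space by drawing
    the two components at two distinct points t and s. *)
Section independent_fubini.
Context d d1 d2 (T : measurableType d) (T1 : measurableType d1)
  (T2 : measurableType d2) (R : realType) (P : probability T R).
Variables (X1 : {RV P >-> T1}) (X2 : {RV P >-> T2}).
Hypothesis X12_indep : forall A B, measurable A -> measurable B ->
  P (X1 @^-1` A `&` X2 @^-1` B) = P (X1 @^-1` A) * P (X2 @^-1` B).

Let pair_meas : measurable_fun setT (fun t => (X1 t, X2 t)).
Proof. exact: measurable_fun_pair. Qed.

Let X12 : {RV P >-> (T1 * T2)%type} := mfun_Sub (mem_set pair_meas).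

Let dist_prod X : measurable X ->
  (distribution P X1 \x distribution P X2) X = distribution P X12 X.
Proof.
apply: product_measure_unique => A B mA mB.
rewrite /distribution /pushforward /=; exact: X12_indep.
Qed.

Variable h : T1 * T2 -> \bar R.
Hypothesis mh : measurable_fun setT h.
Hypothesis ih : P.-integrable setT (fun t => h (X1 t, X2 t)).

Let mh2 t : measurable_fun setT (fun s : T2 => h (t, s)).
Proof. exact: measurableT_comp. Qed.

Let ih12 : (distribution P X1 \x distribution P X2).-integrable setT h.
Proof.
have /integrableP[_ fin] := ih.
apply/integrableP; split => //.
rewrite (eq_measure_integral (distribution P X12)); last first.
  by move=> A mA _; exact: dist_prod.
rewrite ge0_integral_distribution//; exact: measurableT_comp.
Qed.

Let fubini_FE t : fubini_F (distribution P X2) h (X1 t) =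
  \int[P]_s h (X1 t, X2 s).
Proof. by rewrite /fubini_F integral_distributionT. Qed.

Let fubini_F_int :
  P.-integrable setT (fubini_F (distribution P X2) h \o X1).
Proof.
have /integrableP[mF fin] := integrable_fubini_F ih12.
apply/integrableP; split; first exact: measurableT_comp.
move: fin; rewrite ge0_integral_distribution//; exact: measurableT_comp.
Qed.

Lemma indep_integrable_fubini :
  P.-integrable setT (fun t => \int[P]_s h (X1 t, X2 s)).
Proof. by under eq_fun do rewrite -fubini_FE. Qed.

Lemma indep_fubini :
  \int[P]_t h (X1 t, X2 t) = \int[P]_t \int[P]_s h (X1 t, X2 s).
Proof.
transitivity (\int[distribution P X12]_z h z).
  by rewrite integral_distribution.
rewrite (eq_measure_integral (distribution P X1 \x distribution P X2)).
  2: by move=> A mA _; exact: esym (dist_prod mA).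
rewrite -integral12_prod_meas1// integral_distribution//.
- by apply: eq_integral => t _; exact: fubini_FE.
- by have /integrableP[] := integrable_fubini_F ih12.
Qed.

Lemma indep_ae_integrable :
  {ae P, forall t, P.-integrable setT (fun s => h (X1 t, X2 s))}.
Proof.
have [N [mN N0 sN]] := ae_integrable1 ih12.
exists (X1 @^-1` N); split => //.
  by rewrite -[_ @^-1` _]setTI; exact: measurable_funP.
move=> t /= nt; apply: sN => /= it; apply: nt.
have /integrableP[_ fin] := it.
apply/integrableP; split; first exact: (measurableT_comp (mh2 (X1 t))).
move: fin; rewrite ge0_integral_distribution//; exact: measurableT_comp.
Qed.

End independent_fubini.

(** * Sigma-algebras generated by independent families *)

Section cylinders.
Context (T : Type) (R : realType) (I : choiceType) (X : I -> T -> R).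

Definition sigma_gens (D : set I) : set (set T) :=
  [set A | exists i, D i /\ exists B : set R, measurable B /\ A = X i @^-1` B].

(** The events of [sigma_gens] are not stable under intersection; cylinders are
    the pi-system that they generate. *)
Definition cylinder (D : set I) : set (set T) :=
  [set A | exists (J : {fset I}) (B : I -> set R),
    [/\ forall i, measurable (B i), forall i, i \in J -> D i &
        A = \bigcap_(i in [set` J]) (X i @^-1` B i)]].

Lemma cylinderT D : cylinder D setT.
Proof.
exists fset0, (fun=> setT); split => //.
by rewrite set_fset0 bigcap_set0.
Qed.

Lemma cylinder_setI D : setI_closed (cylinder D).
Proof.
move=> _ _ [J1 [B1 [m1 D1 ->]]] [J2 [B2 [m2 D2 ->]]].
exists (J1 `|` J2)%fset, (fun i => (if i \in J1 then B1 i else setT) `&`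
  (if i \in J2 then B2 i else setT)); split.
- by move=> i; apply: measurableI; case: ifP.
- by move=> i; rewrite in_fsetU => /orP[/D1|/D2].
- apply/seteqP; split=> [t [h1 h2] i /= _|t h].
    by split; case: ifP => // iJ; [exact: h1|exact: h2].
  split=> i /= iJ.
    have /= := h i; rewrite in_fsetU iJ => /(_ isT); by case.
  have /= := h i; rewrite in_fsetU iJ orbT => /(_ isT); by case.
Qed.

Lemma sigma_gens_sub_cylinder D : sigma_gens D `<=` cylinder D.
Proof.
move=> _ [i [Di [B [mB ->]]]]; exists [fset i]%fset, (fun=> B); split => //.
  by move=> j; rewrite in_fset1 => /eqP->.
by rewrite set_fset1 bigcap_set1.
Qed.

Lemma sigma_gens_cylinder D : <<s sigma_gens D >> `<=` <<s cylinder D >>.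
Proof. exact: sub_sigma_algebra2 (@sigma_gens_sub_cylinder D). Qed.

End cylinders.

Lemma indep_reindex d (T : measurableType d) (R : realType)
    (P : probability T R) (I J : choiceType) (X : I -> T -> R)
    (f : J -> I) (g : I -> J) : cancel f g ->
  mutually_independent P X -> mutually_independent P (fun j => X (f j)).
Proof.
move=> fK iX A B mB; have := iX [fset f j | j in A]%fset (fun i => B (g i)) _.
rewrite big_imfset/=; last by move=> x y _ _ /(congr1 g); rewrite !fK.
under eq_bigr do rewrite fK.
move=> <- //; congr (P _); apply/seteqP; split=> t h.
  by move=> i /= /imfsetP[j /= jA ->]; rewrite fK; exact: h.
by move=> j /= jA; rewrite -[j in B j]fK; apply: h; apply/imfsetP; exists j.
Qed.

Section independence.
Context d (T : measurableType d) (R : realType) (P : probability T R).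

(** Both sides, as functions of A, are finite measures: they agree on the
    generated sigma-algebra as soon as they agree on a pi-system. *)
Lemma indep_extend (G : set (set T)) (B : set T) :
  G `<=` measurable -> setI_closed G -> G setT -> measurable B ->
  (forall A, G A -> P (A `&` B) = P A * P B) ->
  forall A, <<s G >> A -> P (A `&` B) = P A * P B.
Proof.
move=> mG IG GT mB GB A sA.
have PB0 : (0 <= fine (P B))%R by exact: fine_ge0.
have /= eqm : forall A', G A' -> mrestr P mB A' = mscale (NngNum PB0) P A'.
  move=> A' /GB; rewrite /mrestr /mscale /= => ->.
  by rewrite fineK ?fin_num_measure// muleC.
have fin (k : nat) : mrestr P mB setT < +oo.
  by rewrite /mrestr setTI (le_lt_trans (probability_le1 _ mB))// ltry.
have cov : \bigcup_(k in [set: nat]) (fun=> setT) k = [set: T].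
  by rewrite bigcup_const//; exists 0%N.
have : mrestr P mB A = mscale (NngNum PB0) P A.
  exact: (@g_sigma_algebra_measure_unique _ _ _ G mG (fun=> setT) (fun=> GT) cov
    (mrestr P mB) (mscale (NngNum PB0) P)).
by rewrite /mrestr /mscale /= fineK ?fin_num_measure// muleC.
Qed.

Context (I : choiceType) (X : I -> T -> R).
Hypothesis mX : forall i, measurable_fun setT (X i).

Lemma measurable_cylinder D : cylinder X D `<=` measurable.
Proof.
move=> _ [J [B [mB _ ->]]]; apply: fin_bigcap_measurable => [|i _].
  exact: finite_fset.
by rewrite -[_ @^-1` _]setTI; exact: mX.
Qed.

Lemma measurable_sigma_gens D : <<s sigma_gens X D >> `<=` measurable.
Proof.
apply: (subset_trans (@sigma_gens_cylinder _ _ _ _ _)).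
apply: smallest_sub; first exact: sigma_algebra_measurable.
exact: measurable_cylinder.
Qed.

Lemma cylinder_sub_sigma D : cylinder X D `<=` <<s sigma_gens X D >>.
Proof.
move=> _ [J [B [mB DJ ->]]].
apply: (@fin_bigcap_measurable _ (g_sigma_algebraType (sigma_gens X D))).
  exact: finite_fset.
move=> i /DJ Di; apply: sub_sigma_algebra.
by exists i; split => //; exists (B i).
Qed.

Hypothesis iX : mutually_independent P X.

(** Over disjoint index sets, the intersection of two cylinders is a cylinder
    over the union, and the product rule splits accordingly. *)
Lemma indep_cylinder D1 D2 A B : D1 `&` D2 = set0 ->
  cylinder X D1 A -> cylinder X D2 B -> P (A `&` B) = P A * P B.
Proof.
move=> D12 [J1 [B1 [m1 D1J ->]]] [J2 [B2 [m2 D2J ->]]].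
have J12 i : i \in J2 -> (i \in J1) = false.
  move=> /D2J D2i; apply/negP => /D1J D1i.
  by have : (D1 `&` D2) i by []; rewrite D12.
pose B' i := if i \in J1 then B1 i else B2 i.
have mB i : measurable (B' i) by rewrite /B'; case: ifP.
have -> : \bigcap_(i in [set` J1]) (X i @^-1` B1 i) `&`
    \bigcap_(i in [set` J2]) (X i @^-1` B2 i) =
    \bigcap_(i in [set` (J1 `|` J2)%fset]) (X i @^-1` B' i).
  apply/seteqP; split=> [t [h1 h2] i /=|t h].
    rewrite in_fsetU /B'; case: ifP => [iJ _|_ iJ]; first exact: h1.
    exact: h2.
  split=> i /= iJ; have := h i; rewrite /= in_fsetU iJ /B' ?orbT /= => /(_ isT).
    by rewrite iJ.
  by rewrite J12.
have pJ : perm_eq (J1 `|` J2)%fset (J1 ++ J2 : seq I).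
  apply: uniq_perm; rewrite ?fset_uniq// ?cat_uniq ?fset_uniq ?andbT/=.
    by apply/hasPn => i /J12 ->.
  by move=> i; rewrite in_fsetU mem_cat.
rewrite !iX// (perm_big _ pJ) big_cat/=.
congr (_ * _); apply: eq_big_seq => i iJ; rewrite /B' ?iJ//.
by rewrite J12.
Qed.

Lemma indep_sigma_gens D1 D2 A B : D1 `&` D2 = set0 ->
  <<s sigma_gens X D1 >> A -> <<s sigma_gens X D2 >> B ->
  P (A `&` B) = P A * P B.
Proof.
move=> D12 sA sB; have mA := measurable_sigma_gens sA.
rewrite setIC muleC; apply: (@indep_extend (cylinder X D2)) => //.
- exact: measurable_cylinder.
- exact: cylinder_setI.
- exact: cylinderT.
- move=> {sB}B cB; rewrite setIC muleC.
  apply: (@indep_extend (cylinder X D1)) => //.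
  + exact: measurable_cylinder.
  + exact: cylinder_setI.
  + exact: cylinderT.
  + exact: measurable_cylinder cB.
  + by move=> {sA mA}A cA; apply: indep_cylinder cA cB.
  + exact: sigma_gens_cylinder.
- exact: sigma_gens_cylinder.
Qed.

End independence.

(** * The law of an independent sequence *)

Section sequence_law.
Context d (T : measurableType d) (R : realType) (P : probability T R).
Let coord (i : nat) (w : nat -> R) := w i.
(** Real sequences, with the product sigma-algebra. *)
Definition seqType := g_sigma_algebraType (sigma_gens coord setT).

Lemma measurable_seqP d' (T' : measurableType d') (f : T' -> seqType) :
  (forall i, measurable_fun setT (fun t => f t i)) -> measurable_fun setT f.
Proof.
move=> mf.
apply: (@measurability _ _ T' seqType setT f (sigma_gens coord setT) erefl).
move=> _ [_ [i [_ [B [mB ->]]]] <-].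
exact: (mf i measurableT _ mB).
Qed.

Lemma measurable_coord (i : nat) : measurable_fun setT (coord i : seqType -> R).
Proof.
move=> _ B mB; rewrite setTI; apply: sub_sigma_algebra.
by exists i; split => //; exists B.
Qed.

(** The probability of a cylinder is a product of marginal probabilities, and
    cylinders determine a law. *)
Lemma eq_law_seq (U V : {RV P >-> seqType}) :
  mutually_independent P (fun i t => U t i) ->
  mutually_independent P (fun i t => V t i) ->
  (forall i B, measurable B ->
    P ((fun t => U t i) @^-1` B) = P ((fun t => V t i) @^-1` B)) ->
  forall f : seqType -> \bar R, measurable_fun setT f ->
    \int[P]_t f (U t) = \int[P]_t f (V t).
Proof.
move=> iU iV UV f mf; rewrite -!integral_distributionT//.
apply: eq_measure_integral => A mA _.
have cov : \bigcup_(k in [set: nat]) (fun=> setT) k = [set: seqType].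
  by rewrite bigcup_const//; exists 0%N.
apply: (@g_sigma_algebra_measure_unique _ R seqType (cylinder coord setT)
  (@measurable_cylinder _ _ _ _ _ measurable_coord setT) (fun=> setT) _ cov
  (distribution P U) (distribution P V)).
- by move=> _; exact: cylinderT.
- exact: cylinder_setI.
- move=> _ [J [B [mB _ ->]]].
  rewrite [LHS](iU J B mB) [RHS](iV J B mB).
  by apply: eq_bigr => i _; exact: UV.
- by move=> _; rewrite (le_lt_trans (probability_le1 _ _))// ltry.
- exact: sigma_gens_cylinder.
Qed.

End sequence_law.

(** * Conditioning on a sub-sigma-algebra *)

Section sub_sigma_algebra_measurability.
Context d (T : measurableType d) (R : realType) (P : probability T R).
Implicit Types (G : set (set T)) (f Y Z : T -> R).

(** Measurability with respect to the sigma-algebra generated by G, expressed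
    as measurability on the same carrier equipped with that sigma-algebra, so
    that the usual closure properties apply to it. *)
Definition sub_measurable (G : set (set T)) (f : T -> R) :=
  measurable_fun [set: g_sigma_algebraType G] (f : g_sigma_algebraType G -> R).

Lemma sub_measurableP G f : sub_measurable G f <->
  forall B : set R, measurable B -> <<s G >> (f @^-1` B).
Proof.
split=> [mf B mB|mf _ B mB]; last by rewrite setTI; exact: mf.
by have := mf measurableT B mB; rewrite setTI.
Qed.

Lemma sub_measurable_cst G (r : R) : sub_measurable G (cst r).
Proof. exact: (@measurable_cst _ _ (g_sigma_algebraType G) R setT r). Qed.

Lemma sub_measurableW G G' f : <<s G >> `<=` <<s G' >> ->
  sub_measurable G f -> sub_measurable G' f.
Proof.
move=> GG' /sub_measurableP mf; apply/sub_measurableP => B mB.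
by apply: GG'; exact: mf.
Qed.

Lemma measurable_fun_of_sub G f : <<s G >> `<=` measurable ->
  sub_measurable G f -> measurable_fun setT f.
Proof.
move=> mG /sub_measurableP mf _ B mB; rewrite setTI; apply: mG; exact: mf.
Qed.

(** Uniqueness of conditional expectations.  The restriction of P to the
    sub-sigma-algebra is the law of the identity map, and for that measure a
    function is determined up to a null set by its integrals over measurable
    sets. *)
Lemma sub_measurable_ae_eq G Y Z :
  <<s G >> `<=` measurable -> sub_measurable G Y -> sub_measurable G Z ->
  P.-integrable setT (EFin \o Y) -> P.-integrable setT (EFin \o Z) ->
  (forall A, <<s G >> A ->
    \int[P]_(t in A) (Y t)%:E = \int[P]_(t in A) (Z t)%:E) ->
  {ae P, forall t, Y t = Z t}.
Proof.
move=> mG sY sZ iY iZ YZ.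
have mid : measurable_fun setT (id : T -> g_sigma_algebraType G).
  by move=> _ B mB; rewrite setTI; exact: mG.
have [mY mZ] : measurable_fun [set: g_sigma_algebraType G] (EFin \o Y) /\
    measurable_fun [set: g_sigma_algebraType G] (EFin \o Z).
  by split; apply/measurable_EFinP.
pose Q := distribution P (mfun_Sub (mem_set mid) : {RV P >-> _}).
have iQ (V : T -> R) :
    measurable_fun [set: g_sigma_algebraType G] (EFin \o V) ->
    P.-integrable setT (EFin \o V) -> Q.-integrable setT (EFin \o V).
  move=> mV iV; exact: (integrable_pushforward mid mV iV).
have eQ (V : T -> R) A :
    measurable_fun [set: g_sigma_algebraType G] (EFin \o V) ->
    P.-integrable setT (EFin \o V) -> <<s G >> A ->
    \int[Q]_(t in A) (V t)%:E = \int[P]_(t in A) (V t)%:E.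
  move=> mV iV sA.
  apply: (@integral_pushforward _ _ _ _ _ _ mid P A (EFin \o V)) => //.
  apply: integrableS iV => //; exact: mG.
have aeQ : ae_eq Q setT (EFin \o Y) (EFin \o Z).
  apply: integral_ae_eq => //; first exact: iQ.
  by move=> E _ mE; rewrite /= !eQ//; exact: YZ.
case: aeQ => N [mN QN sN]; exists N; split => //; first exact: mG.
move=> t nt; apply: sN => /= yz; apply: nt.
by case: (yz Logic.I).
Qed.

End sub_sigma_algebra_measurability.

(** Conditional expectation of K (V + S) when V is known to the
    sub-sigma-algebra and S is independent of it: V is frozen and S averaged
    out. *)
Section freezing.
Context d (T : measurableType d) (R : realType) (P : probability T R).
Variables (G : set (set T)) (V S : T -> R) (K : R -> R).
Hypothesis mG : <<s G >> `<=` measurable.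
Hypothesis sV : sub_measurable G V.
Hypothesis mS : measurable_fun setT S.
Hypothesis VS_indep : forall A B, <<s G >> A -> measurable B ->
  P (A `&` S @^-1` B) = P A * P (S @^-1` B).
Hypothesis mK : measurable_fun setT K.
Hypothesis LK : (fun t => K (V t + S t)%R) \in Lfun P 2%:E.

Definition average (w : R) : \bar R := \int[P]_s (K (w + S s)%R)%:E.

Let mV : measurable_fun setT V. Proof. exact: measurable_fun_of_sub sV. Qed.

Lemma measurable_average : measurable_fun setT average.
Proof.
pose f (z : R * T) := (K (z.1 + S z.2)%R)%:E.
have mf : measurable_fun setT f.
  apply/measurable_EFinP; apply: measurableT_comp => //.
  by apply: measurable_funD => //; exact: measurableT_comp.
rewrite (_ : average = fubini_F P f^\+ \- fubini_F P f^\-).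
  apply: emeasurable_funB; apply: measurable_fun_fubini_tonelli_F => //.
    exact: measurable_funepos.
  exact: measurable_funeneg.
apply/funext => w; rewrite /average [LHS]integralE /=.
by congr (_ - _); apply: eq_integral => x _; rewrite ?funeposE ?funenegE.
Qed.

(* *)
(** Fubini for a random element Y that the sub-sigma-algebra knows.  It is used
    with Y = V to bound second moments and with Y = (phi, V) to condition. *)
Let fub d1 (T1 : measurableType d1) (Y : T -> T1)
    (h : T1 * R -> \bar R) :
  (forall A, measurable A -> <<s G >> (Y @^-1` A)) -> 
  measurable_fun setT h ->
  P.-integrable setT (fun t => h (Y t, S t)) ->
  [/\ {ae P, forall t, P.-integrable setT (fun s => h (Y t, S s))},
      P.-integrable setT (fun t => \int[P]_s h (Y t, S s)) &
      \int[P]_t h (Y t, S t) = \int[P]_t \int[P]_s h (Y t, S s)].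
Proof.
move=> sY mh ih.
have mY : measurable_fun setT Y.
  by move=> _ B mB; rewrite setTI; apply: mG; exact: sY.
pose Y' : {RV P >-> T1} := mfun_Sub (mem_set mY).
pose S' : {RV P >-> R} := mfun_Sub (mem_set mS).
have ind A B : measurable A -> measurable B ->
  P (Y' @^-1` A `&` S' @^-1` B) = P (Y' @^-1` A) * P (S' @^-1` B).
  by move=> mA mB; apply: VS_indep => //; exact: sY.
split.
- exact: (@indep_ae_integrable _ _ _ _ _ _ _ _ Y' S' ind h).
- exact: (@indep_integrable_fubini _ _ _ _ _ _ _ _ Y' S' ind h).
- exact: (@indep_fubini _ _ _ _ _ _ _ _ Y' S' ind h).
Qed.

Let fub_sqr : [/\ {ae P, forall t,
      P.-integrable setT (fun s => (K (V t + S s) ^+ 2)%:E)},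
    P.-integrable setT (fun t => \int[P]_s (K (V t + S s) ^+ 2)%:E) &
    \int[P]_t (K (V t + S t) ^+ 2)%:E =
      \int[P]_t \int[P]_s (K (V t + S s) ^+ 2)%:E].
Proof.
apply: (@fub _ R V (fun z => (K (z.1 + z.2) ^+ 2)%:E)).
- by move=> A mA; exact: (sub_measurableP _ _).1.
- apply/measurable_EFinP; apply: measurable_funX; apply: measurableT_comp => //.
  exact: measurable_funD.
- exact: Lfun2_integrable_sqr.
Qed.

Let section_Lfun2 :
  {ae P, forall t, (fun s => K (V t + S s)%R) \in Lfun P 2%:E}.
Proof.
have [+ _ _] := fub_sqr; apply: filterS => t /integrableP[_ fin].
apply/Lfun2P; first by apply: measurableT_comp => //; exact: measurable_funD.
by under eq_integral do rewrite -[X in X%:E]ger0_norm ?sqr_ge0//.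
Qed.

Let mg : measurable_fun setT (fun t => fine (average (V t))).
Proof.
apply: measurableT_comp => //; apply: measurableT_comp => //.
exact: measurable_average.
Qed.

(** Jensen: the square of an average is at most the average of the square. *)
Lemma average_Lfun2 : (fun t => fine (average (V t))) \in Lfun P 2%:E.
Proof.
apply/Lfun2P => //; have [_ /integrableP[mI fin] _] := fub_sqr.
apply: le_lt_trans fin; apply: ae_ge0_le_integral => //.
- by move=> t _; rewrite lee_fin sqr_ge0.
- by apply/measurable_EFinP; exact: measurable_funX.
- exact: measurableT_comp.
apply: filterS section_Lfun2 => t Lt _.
rewrite gee0_abs; last by apply: integral_ge0 => s _; rewrite lee_fin sqr_ge0.
have := cauchy_schwarz Lt (Lfun_cst P 1%R 2%R).
rewrite {2}/l2norm [X in Num.sqrt X](_ : _ = 1)%R; last first.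
  under eq_Rintegral do rewrite expr1n.
  rewrite Rintegral_cst// mul1r.
  by rewrite [X in fine X](_ : _ = 1) //; exact: probability_setT.
under eq_Rintegral do rewrite mulr1.
rewrite sqrtr1 mulr1 => le.
have ge0 : (0 <= \int[P]_s (K (V t + S s) ^+ 2))%R.
  by apply: Rintegral_ge0 => s _; exact: sqr_ge0.
have : (`|\int[P]_s K (V t + S s)| ^+ 2 <=
    l2norm P (fun s => K (V t + S s)) ^+ 2)%R.
  by rewrite lerXn2r ?nnegrE ?l2norm_ge0.
rewrite real_normK ?num_real// sqr_sqrtr// -lee_fin /Rintegral.
rewrite fineK//; exact: integrable_fin_num (Lfun2_integrable_sqr Lt).
Qed.

Lemma average_condexp (phi : T -> R) : sub_measurable G phi ->
  phi \in Lfun P 2%:E ->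
  (\int[P]_t (phi t * K (V t + S t)) =
   \int[P]_t (phi t * fine (average (V t))))%R.
Proof.
move=> sphi Lphi.
have [| | |_ ii e] := @fub _ (R * R)%type (fun t => (phi t, V t))
  (fun z => (z.1.1 * K (z.1.2 + z.2))%:E).
- move=> A mA; rewrite -[_ @^-1` _]setTI.
  exact: (@measurable_fun_pair _ _ _ (g_sigma_algebraType G) R R phi V).
- apply/measurable_EFinP; apply: measurable_funM.
    by apply: measurableT_comp.
  apply: measurableT_comp => //; apply: measurable_funD => //.
  exact: measurableT_comp.
- exact: mul_integrable.
rewrite /Rintegral e; congr fine; apply: ae_eq_integral => //.
- by case/integrableP: ii.
- apply/measurable_EFinP; apply: measurable_funM => //.
  exact: Lfun_meas Lphi.
apply: filterS section_Lfun2 => t Lt _ /=.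
under eq_integral do rewrite EFinM.
rewrite integralZl//; last exact: Lfun2_integrable.
rewrite EFinM fineK// integrable_fin_num//; exact: Lfun2_integrable.
Qed.

End freezing.

(** * Triviality of the remote past *)

(** The random variables W k are centered, bounded in quadratic mean, and
    depend on the part D k of the family, where D k eventually avoids every
    index.  An event that depends on finitely many indices is eventually
    independent of W k; the events, and then the random variables, that are
    asymptotically uncorrelated with W k are stable under limits, because
    correlation with a bounded sequence is equicontinuous. *)
Section mixing.
Import HBSimple HBNNSimple.
Context d (T : measurableType d) (R : realType) (P : probability T R).
Context (I : choiceType) (X : I -> T -> R).
Hypothesis mX : forall i, measurable_fun setT (X i).
Hypothesis iX : mutually_independent P X.

Let sm D (f : T -> R) : sub_measurable (sigma_gens X D) f ->
  measurable_fun setT f.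
Proof. by apply: measurable_fun_of_sub; exact: measurable_sigma_gens. Qed.

Lemma indep_expectM D1 D2 (f g : T -> R) : D1 `&` D2 = set0 ->
  sub_measurable (sigma_gens X D1) f -> sub_measurable (sigma_gens X D2) g ->
  P.-integrable setT (EFin \o f) -> P.-integrable setT (EFin \o g) ->
  P.-integrable setT (EFin \o (fun t => f t * g t)%R) ->
  (\int[P]_t (f t * g t) = \int[P]_t f t * \int[P]_t g t)%R.
Proof.
move=> D12 sf sg if_ ig ifg.
pose f' : {RV P >-> R} := mfun_Sub (mem_set (sm sf)).
pose g' : {RV P >-> R} := mfun_Sub (mem_set (sm sg)).
have ind (A B : set R) : measurable A -> measurable B ->
    P (f' @^-1` A `&` g' @^-1` B) = P (f' @^-1` A) * P (g' @^-1` B).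
  move=> mA mB; apply: (indep_sigma_gens mX iX D12).
    exact: (sub_measurableP _ _).1.
  exact: (sub_measurableP _ _).1.
have mh : measurable_fun setT (fun xy : R * R => (xy.1 * xy.2)%:E).
  by apply/measurable_EFinP; exact: measurable_funM.
have := @indep_fubini _ _ _ _ _ _ _ _ _ _ ind _ mh ifg.
rewrite /Rintegral /= => ->.
rewrite -fineM ?integrable_fin_num//; congr fine.
have /fineK Eg := integrable_fin_num measurableT ig.
rewrite /= in Eg; rewrite -[in RHS]Eg -integralZr//.
apply: eq_integral => t _; under eq_integral do rewrite EFinM.
by rewrite integralZl// [in RHS]Eg.
Qed.

Variables (D : nat -> set I) (W : nat -> T -> R) (c : R).
Hypothesis D_vanish : forall i, exists N, forall k, (N <= k)%N -> ~ D k i.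
Hypothesis sW : forall k, sub_measurable (sigma_gens X (D k)) (W k).
Hypothesis LW : forall k, W k \in Lfun P 2%:E.
Hypothesis W0 : forall k, (\int[P]_t W k t = 0)%R.
Hypothesis Wc : forall k, (l2norm P (W k) <= c)%R.

Local Open Scope ring_scope.

Let vanishing (Z : T -> R) := \int[P]_t (W k t * Z t) @[k --> \oo] --> 0.

Let vanishingD Y Z : Y \in Lfun P 2%:E -> Z \in Lfun P 2%:E ->
  vanishing Y -> vanishing Z -> vanishing (fun t => Y t + Z t).
Proof.
move=> LY LZ vY vZ; rewrite /vanishing.
rewrite (_ : (fun k => _) = (fun k => \int[P]_t (W k t * Y t)) \+
    (fun k => \int[P]_t (W k t * Z t))); last first.
  apply/funext => k /=; under eq_Rintegral do rewrite mulrDr.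
  by rewrite RintegralD//; exact: mul_integrable.
by rewrite -(addr0 0); exact: cvgD.
Qed.

Let vanishingZ a Z : Z \in Lfun P 2%:E ->
  vanishing Z -> vanishing (fun t => a * Z t).
Proof.
move=> LZ vZ; rewrite /vanishing.
rewrite (_ : (fun k => _) = (fun k => a * \int[P]_t (W k t * Z t))); last first.
  apply/funext => k /=; under eq_Rintegral do rewrite mulrCA.
  by rewrite RintegralZl//; exact: mul_integrable.
by rewrite -(mulr0 a); apply: cvgM => //; exact: cvg_cst.
Qed.

(** The uniform bound c makes the functionals Z |-> E[W k Z] equicontinuous. *)
Let vanishing_approx Z : Z \in Lfun P 2%:E ->
  (forall e, 0 < e -> exists2 Y, Y \in Lfun P 2%:E /\ vanishing Y &
     l2norm P (fun t => Z t - Y t) <= e) ->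
  vanishing Z.
Proof.
move=> LZ ap; apply/cvgr0Pnorm_le => e e0.
have c0 : 0 <= c by apply: le_trans (Wc 0%N); exact: l2norm_ge0.
(* c may be 0, hence c + 1 in the denominator *)
have d0 : 0 < e / 2 / (c + 1) by rewrite !divr_gt0// ltr_wpDl.
have [Y [LY /cvgr0Pnorm_le vY] ZY] := ap _ d0.
have := vY _ (divr_gt0 e0 (ltr0n R 2)).
apply: filterS => k WY.
have LD : (fun t => Z t - Y t) \in Lfun P 2%:E by exact: Lfun2B.
have -> : \int[P]_t (W k t * Z t) =
    \int[P]_t (W k t * (Z t - Y t)) + \int[P]_t (W k t * Y t).
  rewrite -RintegralD//; try exact: mul_integrable.
  by apply: eq_Rintegral => t _; rewrite mulrBr subrK.
rewrite (le_trans (ler_normD _ _))// [leRHS](splitr e) lerD//.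
rewrite (le_trans (cauchy_schwarz _ _))//.
apply: (@le_trans _ _ (c * (e / 2 / (c + 1)))).
  by apply: ler_pM => //; exact: l2norm_ge0.
rewrite mulrCA ler_piMr ?divr_ge0 ?(ltW e0)//.
by rewrite ler_pdivrMr ?ltr_wpDl// mul1r lerDl.
Qed.

Let vanishing_cylinder A : cylinder X setT A -> vanishing \1_A.
Proof.
move=> /[dup] /(measurable_cylinder mX) mA [J [B [mB _ AE]]].
have [N DN] : exists N, forall k, (N <= k)%N -> forall i, i \in J -> ~ D k i.
  have /choice[f fP] := D_vanish.
  exists (\max_(i <- J) f i)%N => k Nk i iJ; apply: fP.
  by apply: leq_trans Nk; exact: leq_bigmax_seq.
apply: cvg_near_cst; exists N => // k /= Nk.
have sA : <<s sigma_gens X (~` D k) >> A.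
  by apply: cylinder_sub_sigma; exists J, B; split => //; exact: DN Nk.
rewrite (@indep_expectM (D k) (~` D k)) ?W0 ?mul0r ?setICr//.
- exact: (@measurable_indic _ (g_sigma_algebraType (sigma_gens X (~` D k)))).
- exact: Lfun2_integrable.
- by apply: Lfun2_integrable; exact: indic_Lfun2.
- by apply: mul_integrable => //; exact: indic_Lfun2.
Qed.

(** Finite unions are handled by linearity, and approximate the countable one
    in quadratic mean. *)
Let vanishing_bigcup (F : (set T)^nat) : (forall n, measurable (F n)) ->
  trivIset setT F -> (forall n, vanishing \1_(F n)) ->
  vanishing \1_(\bigcup_k F k).
Proof.
move=> mF tF vF.
pose A_ n := \big[setU/set0]_(i < n) F i.
have mA_ n : measurable (A_ n) by exact: bigsetU_measurable.
have vA_ n : vanishing \1_(A_ n).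
  elim: n => [|n IH].
    rewrite /A_ big_ord0 /vanishing (_ : (fun k => _) = cst 0).
      exact: cvg_cst.
    apply/funext => k; under eq_Rintegral do rewrite indic0 mulr0.
    by rewrite Rintegral_cst// mul0r.
  rewrite (_ : \1_(A_ n.+1) = (fun t => \1_(A_ n) t + \1_(F n) t)).
    by apply: vanishingD => //; exact: indic_Lfun2.
  apply/funext => t; rewrite /A_ big_ord_recr/= !indicE in_setU.
  case: (boolP (t \in F n)) => [tn|_]; last by rewrite orbF addr0.
  case: (boolP (t \in _)) => [|_]; last by rewrite add0r.
  rewrite inE -bigcup_mkord => -[i /= ni ti].
  have ein := tF i n Logic.I Logic.I (ex_intro _ t (conj ti (set_mem tn))).
  by rewrite ein ltnn in ni.
apply: vanishing_approx; first exact/indic_Lfun2/bigcupT_measurable.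
move=> e e0.
have [||||n nP] := @l2_dominated _ _ _ P (fun n => \1_(A_ n))
    \1_(\bigcup_k F k) (cst 1) e _ _ (Lfun_cst _ _ _) _ _ e0.
+ by move=> n; exact: measurable_indic.
+ exact/measurable_indic/bigcupT_measurable.
+ move=> n t; rewrite indicE normr1.
  by case: (_ \in _); rewrite ?normr1 ?normr0.
+ move=> t; apply: cvg_near_cst.
  have [[N _ tN]|nt] := pselect ((\bigcup_k F k) t).
    exists N.+1 => // n /= Nn; rewrite !indicE !mem_set//; first by exists N.
    by rewrite /A_ -bigcup_mkord; exists N.
  apply: nearW => n; rewrite !indicE !memNset// /A_ -bigcup_mkord => -[i _ ti].
  by apply: nt; exists i.
+ exists \1_(A_ n) => //; split; [exact: indic_Lfun2|exact: vA_].
Qed.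

Let sub_meas (S : set T) : <<s cylinder X setT >> S -> measurable S.
Proof.
apply: smallest_sub; first exact: sigma_algebra_measurable.
exact: measurable_cylinder.
Qed.

Let vanishing_set A : <<s cylinder X setT >> A -> vanishing \1_A.
Proof.
move=> sA; apply: (@dynkin_induction _ (g_sigma_algebraType (cylinder X setT))
  (cylinder X setT) (fun A => vanishing \1_A)) sA => //.
- exact: cylinder_setI.
- exact/vanishing_cylinder/cylinderT.
- move=> S /sub_meas mS vS.
  rewrite (_ : \1_(~` S) = (fun t => \1_setT t + - 1 * \1_S t)).
    apply: vanishingD => //; first exact: indic_Lfun2.
    2: exact/vanishing_cylinder/cylinderT.
      by apply: Lfun2Z; exact: indic_Lfun2.
    by apply: vanishingZ => //; exact: indic_Lfun2.
  apply/funext => t; rewrite !indicE in_setC in_setT mulN1r.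
  by case: (t \in S); rewrite /= ?subrr ?subr0.
- move=> F mF tF vF; apply: vanishing_bigcup => // n.
  by apply: sub_meas; exact: mF.
Qed.

Let vanishing_sum (r : seq R) (A_ : R -> set T) :
  (forall y, <<s cylinder X setT >> (A_ y)) ->
  (fun t => \sum_(y <- r) y * \1_(A_ y) t) \in Lfun P 2%:E /\
  vanishing (fun t => \sum_(y <- r) y * \1_(A_ y) t).
Proof.
move=> sA; have LA y : (\1_(A_ y) : T -> R) \in Lfun P 2%:E.
  by apply: indic_Lfun2; apply: sub_meas; exact: sA.
elim: r => [|y r [Lr vr]].
  under eq_fun do rewrite big_nil; split; first exact: Lfun_cst.
  have := vanishingZ 0 (LA 0) (vanishing_set (sA 0)).
  by under eq_fun do rewrite mul0r.
under eq_fun do rewrite big_cons; split.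
  by apply: Lfun2D => //; exact: Lfun2Z.
apply: vanishingD => //; first exact: Lfun2Z.
by apply: vanishingZ => //; apply: vanishing_set; exact: sA.
Qed.

(** Density of the simple functions. *)
Let mixing_ge0 Z : Z \in Lfun P 2%:E -> sub_measurable (cylinder X setT) Z ->
  (forall t, 0 <= Z t) -> vanishing Z.
Proof.
move=> LZ sZ Z0; apply: vanishing_approx => // e e0.
have mZ : measurable_fun [set: g_sigma_algebraType (cylinder X setT)]
    (fun t : g_sigma_algebraType (cylinder X setT) => (Z t)%:E).
  exact/measurable_EFinP.
pose g := nnsfun_approx measurableT mZ.
have gZ t : g n t @[n --> \oo] --> Z t.
  have := cvg_nnsfun_approx measurableT mZ (fun t _ => Z0 t) (x := t) Logic.I.
  by move=> /fine_cvgP[_].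
have gE n : (g n : T -> R) = (fun t => \sum_(y <- fset_set (range (g n)))
    y * \1_(g n @^-1` [set y]) t).
  by apply/funext => t; rewrite fimfunE fsbig_finite.
have sg n y : <<s cylinder X setT >> (g n @^-1` [set y]).
  exact: (measurable_funPTI (g n) (measurable_set1 y)).
have Lvg n : (g n : T -> R) \in Lfun P 2%:E /\ vanishing (g n).
  by rewrite gE; apply: vanishing_sum; exact: sg.
have [|||n nP] := @l2_dominated _ _ _ P (fun n => g n) Z Z e _ _ LZ _ gZ e0.
- by move=> n; apply: Lfun_meas (Lvg n).1.
- exact: Lfun_meas LZ.
- move=> n t; rewrite !ger0_norm//.
  rewrite -(cvg_lim (@Rhausdorff R) (gZ t)).
  apply: (@nondecreasing_cvgn_le _ (fun n => g n t)); last exact: cvgP (gZ t).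
  by move=> m k mk; have /lefP := nd_nnsfun_approx measurableT mZ mk; exact.
by exists (g n); first exact: Lvg.
Qed.

Lemma mixing Z : Z \in Lfun P 2%:E -> sub_measurable (cylinder X setT) Z ->
  \int[P]_t (W k t * Z t) @[k --> \oo] --> 0.
Proof.
move=> LZ sZ.
have mZ := Lfun_meas LZ.
have -> : Z = (fun t => Z^\+ t + - 1 * Z^\- t).
  by apply/funext => t; rewrite -[in LHS](funrposBneg Z) mulN1r.
have absE t : Z^\+ t + Z^\- t = `|Z t|.
  by rewrite -[RHS]/((Num.norm \o Z) t) -funrposDneg.
have Lp : Z^\+ \in Lfun P 2%:E.
  apply: Lfun2_dom LZ; first exact: measurable_funrpos.
  by move=> t; rewrite ger0_norm ?funrpos_ge0// -absE lerDl funrneg_ge0.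
have Ln : Z^\- \in Lfun P 2%:E.
  apply: Lfun2_dom LZ; first exact: measurable_funrneg.
  by move=> t; rewrite ger0_norm ?funrneg_ge0// -absE lerDr funrpos_ge0.
apply: vanishingD => //; first exact: Lfun2Z.
- by apply: mixing_ge0 => //; exact: measurable_funrpos.
apply: vanishingZ => //.
by apply: mixing_ge0 => //; exact: measurable_funrneg.
Qed.
End mixing.

(** * Deterministic lemmas: linear filters, telescoping sums *)

Section linear_filter.
Context (R : realType) (a : nat -> R).
Local Open Scope ring_scope.

(** [head_sum m] is the contribution of the first m entries of w and
    [tail_sum m] that of all the others.  The upper limit makes the tail a
    measurable function of every sequence, and one that ignores the first m
    entries even where the series diverges. *)
Definition head_sum (m : nat) (w : nat -> R) : R := \sum_(0 <= i < m) a i * w i.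

Definition tail_sum (m : nat) (w : nat -> R) : R :=
  fine (limn_esup (fun N => (\sum_(m <= i < N) a i * w i)%:E)).

Lemma head_tail w x m : series (fun i => a i * w i) @ \oo --> x ->
  x = tail_sum m w + head_sum m w.
Proof.
move=> cx; suff -> : tail_sum m w = x - head_sum m w by rewrite subrK.
have cS : (\sum_(m <= i < N) a i * w i)%:E @[N --> \oo] -->
    (x - head_sum m w)%:E.
  apply: cvg_EFin; first exact: nearW.
  rewrite (_ : fine \o _ = (fun N => \sum_(m <= i < N) a i * w i))//.
  apply: (@cvg_trans _
    ((fun N => series (fun i => a i * w i) N - head_sum m w) @ \oo)).
    apply: near_eq_cvg; exists m => // N /= mN.
    by rewrite /series /head_sum/= (big_cat_nat _ mN)//= addrAC subrr add0r.
  by apply: cvgB => //; exact: cvg_cst.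
by rewrite /tail_sum (cvg_limn_einf_sup cS).2.
Qed.

Section measurability.
Context d (T : measurableType d) (w : nat -> T -> R).

Lemma measurable_weighted_sum m N :
  (forall i, (m <= i < N)%N -> measurable_fun setT (w i)) ->
  measurable_fun setT (fun t => \sum_(m <= i < N) a i * w i t).
Proof.
move=> mw; rewrite (_ : (fun t => _) = (fun t => \sum_(i <- index_iota m N)
  (if (m <= i < N)%N then a i * w i t else 0))).
  apply: measurable_sum => i; case: (boolP (m <= i < N)%N) => [iN|_];
    last exact: measurable_cst.
  by apply: measurable_funM; [exact: measurable_cst|exact: mw].
apply/funext => t; rewrite [LHS]big_seq [RHS]big_seq; apply: eq_bigr => i.
by rewrite mem_index_iota => ->.
Qed.

Lemma measurable_tail m : (forall i, (m <= i)%N -> measurable_fun setT (w i)) ->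
  measurable_fun setT (fun t => tail_sum m (w ^~ t)).
Proof.
move=> mw; apply: measurableT_comp => //.
apply: measurable_fun_limn_esup => N; apply/measurable_EFinP.
by apply: measurable_weighted_sum => i /andP[mi _]; exact: mw.
Qed.

End measurability.
End linear_filter.

Section telescoping.
Local Open Scope ring_scope.

(** Each [b h 0 - l h] telescopes into terms bounded by [c k * c (h + k)], and
    the double sum of these is at most the square of the sum of c. *)
Lemma telescoping_bound (R : realType) (b : nat -> nat -> R)
    (l c : nat -> R) (A : R) :
  (forall h k, `|b h k - b h k.+1| <= c k * c (h + k)%N)%R ->
  (forall h, b h k @[k --> \oo] --> l h) ->
  (forall k, 0 <= c k)%R -> (forall N, \sum_(0 <= k < N) c k <= A)%R ->
  forall H, (\sum_(0 <= h < H) `|b h 0%N - l h| <= A ^+ 2)%R.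
Proof.
move=> bc bl c0 cA H.
have tele h N : `|b h 0%N - b h N| <= \sum_(0 <= k < N) c k * c (h + k)%N.
  elim: N => [|N IH]; first by rewrite subrr normr0 big_nil.
  rewrite big_nat_recr//=.
  by rewrite -(subrKA (b h N)) (le_trans (ler_normD _ _))// lerD.
have A0 : 0 <= A by have := cA 0%N; rewrite big_nil.
have fin N : \sum_(0 <= h < H) `|b h 0%N - b h N| <= A ^+ 2.
  apply: (@le_trans _ _
    (\sum_(0 <= h < H) \sum_(0 <= k < N) c k * c (h + k)%N)).
    by apply: ler_sum => h _; exact: tele.
  rewrite exchange_big/=.
  apply: (@le_trans _ _ (\sum_(0 <= k < N) c k * A)).
    apply: ler_sum => k _; rewrite -mulr_sumr ler_wpM2l//.
    apply: le_trans (cA (k + H)%N).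
    have -> : \sum_(0 <= h < H) c (h + k)%N = \sum_(0 + k <= i < k + H) c i.
      by rewrite big_addn addKn.
    rewrite add0n (@big_cat_nat _ _ _ k 0 (k + H))//= ?leq_addr//.
    by rewrite lerDr sumr_ge0.
  by rewrite -mulr_suml expr2 ler_wpM2r.
have cv : \sum_(0 <= h < H) `|b h 0%N - b h N| @[N --> \oo] -->
    \sum_(0 <= h < H) `|b h 0%N - l h|.
  have cvh h : `|b h 0%N - b h N| @[N --> \oo] --> `|b h 0%N - l h|.
    by apply: cvg_norm; apply: cvgB; [exact: cvg_cst|exact: bl].
  clear fin; elim: H => [|H IH].
    by under eq_fun do rewrite big_nil; rewrite big_nil; exact: cvg_cst.
  under eq_fun do rewrite big_nat_recr//=; rewrite big_nat_recr//=.
  exact: cvgD.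
rewrite -(cvg_lim (@Rhausdorff R) cv).
by apply: limr_le; [exact: cvgP cv|exact: nearW].
Qed.

End telescoping.

(** * The linear process *)

Section linear_process.
Context (R : realType) (d : measure_display) (T : measurableType d)
  (P : probability T R) (eps : int -> {RV P >-> R}).
Hypothesis eps_indep : mutually_independent P (fun i => eps i : T -> R).
Hypothesis eps_id : identically_distributed P (fun i => eps i : T -> R).
Hypothesis eps_mean : forall i, 'E_P[eps i] = 0.
Variables (a : nat -> R) (X : nat -> {RV P >-> R}).
Hypothesis X_linear : forall n : nat,
  {ae P, forall t,
    series (fun i : nat => (a i * eps (n%:Z - i%:Z)%R t)%R) @ \oo
      --> (X n t : R)}.

Let e i : T -> R := eps i.
Let me i : measurable_fun setT (e i). Proof. exact: measurable_funP. Qed.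

Definition past (j : int) : set int := [set i | (i <= j)%R].
Definition future (j : int) : set int := [set i | (j < i)%R].

Local Notation pastF j := (sigma_gens e (past j)).

Lemma past_future j : past j `&` future j = set0.
Proof.
apply/seteqP; split => // i [/= ij ji].
by have := lt_le_trans ji ij; rewrite ltxx.
Qed.

(** The past of time n, read backwards. *)
Definition innovations (n : nat) (t : T) : seqType R :=
  fun i : nat => eps (n%:Z - i%:Z)%R t.

Local Notation tailX n m := (fun t => tail_sum a m (innovations n t)).
Local Notation headX n m := (fun t => head_sum a m (innovations n t)).

Lemma measurable_innovations n : measurable_fun setT (innovations n).
Proof. by apply: measurable_seqP => i; exact: me. Qed.

Let innovRV n : {RV P >-> seqType R} :=
  mfun_Sub (mem_set (measurable_innovations n)).

Lemma innovations_indep n :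
  mutually_independent P (fun i t => innovations n t i).
Proof.
(* i |-> n - i is injective on nat, with left inverse k |-> |n - k| *)
apply: (@indep_reindex _ _ _ _ _ _ e (fun i : nat => n%:Z - i%:Z)%R
  (fun k : int => `|n%:Z - k|%N)) => //.
by move=> i; lia.
Qed.

Lemma innovations_law n n' (f : seqType R -> \bar R) : measurable_fun setT f ->
  \int[P]_t f (innovations n t) = \int[P]_t f (innovations n' t).
Proof.
move=> mf; apply: (@eq_law_seq _ _ _ _ (innovRV n) (innovRV n')) => //.
- exact: innovations_indep.
- exact: innovations_indep.
- by move=> i B mB; exact: eps_id.
Qed.

Let sF D i : D i -> sub_measurable (sigma_gens e D) (e i).
Proof.
move=> Di; apply/sub_measurableP => B mB; apply: sub_sigma_algebra.
by exists i; split => //; exists B.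
Qed.

Let mF D : <<s sigma_gens e D >> `<=` measurable.
Proof. exact: measurable_sigma_gens. Qed.

Lemma sigma_gensS D D' : D `<=` D' ->
  <<s sigma_gens e D >> `<=` <<s sigma_gens e D' >>.
Proof.
move=> DD; apply: sub_sigma_algebra2 => A [i [Di h]].
by exists i; split => //; exact: DD.
Qed.

Lemma pastS (i j : int) : (i <= j)%R -> past i `<=` past j.
Proof. by move=> ij k; rewrite /past /=; lia. Qed.

Lemma tail_past n m :
  sub_measurable (pastF (n%:Z - m%:Z)%R) (tailX n m).
Proof.
apply: (@measurable_tail _ a _ (g_sigma_algebraType _)
  (fun i t => e (n%:Z - i%:Z)%R t)).
by move=> i mi; apply: sF; rewrite /past /=; lia.
Qed.

Lemma head_future n m :
  sub_measurable (sigma_gens e (future (n%:Z - m%:Z)%R)) (headX n m).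
Proof.
apply: (@measurable_weighted_sum _ a _ (g_sigma_algebraType _)
  (fun i t => e (n%:Z - i%:Z)%R t)).
by move=> i mi; apply: sF; rewrite /future /=; lia.
Qed.

Lemma measurable_tail_seq m :
  measurable_fun setT (tail_sum a m : seqType R -> R).
Proof.
exact: (@measurable_tail _ a _ (seqType R) (fun i w => w i)
  m (fun i _ => measurable_coord i)).
Qed.

Lemma measurable_head_seq m :
  measurable_fun setT (head_sum a m : seqType R -> R).
Proof.
exact: (@measurable_weighted_sum _ a _ (seqType R) (fun i w => w i)
  0 m (fun i _ => measurable_coord i)).
Qed.

Lemma X_decomp n : {ae P, forall t, forall m,
  X n t = (tail_sum a m (innovations n t) + head_sum a m (innovations n t))%R}.
Proof. by apply: filterS (X_linear n) => t h m; exact: head_tail. Qed.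

Lemma eps_integrable i : P.-integrable setT (EFin \o e i).
Proof.
apply: integrable_of_integral_fin => //.
by have := eps_mean i; rewrite unlock => ->.
Qed.

Lemma head_integrable n m :
  P.-integrable setT (EFin \o (headX n m)).
Proof.
rewrite /head_sum (_ : _ \o _ = fun t => \sum_(0 <= i < m)
    (a i * e (n%:Z - i%:Z)%R t)%:E); last first.
  by apply/funext => t; rewrite /= sumEFin.
apply: integrable_sum => // i _.
under eq_fun do rewrite EFinM.
by apply: integrableZl => //; exact: eps_integrable.
Qed.

Lemma head_mean0 n m : (\int[P]_t head_sum a m (innovations n t) = 0)%R.
Proof.
elim: m => [|m IH]; rewrite /head_sum.
  by under eq_Rintegral do rewrite big_nil; rewrite Rintegral_cst// mul0r.
under eq_Rintegral do rewrite big_nat_recr//=.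
have ie := eps_integrable (n%:Z - m%:Z)%R.
rewrite RintegralD//; first 1 last.
- exact: head_integrable.
- rewrite (_ : _ \o _ = fun t => (a m)%:E * (e (n%:Z - m%:Z)%R t)%:E).
    exact: integrableZl.
  by apply/funext => t; rewrite /= EFinM.
rewrite -/(head_sum a m _) IH add0r RintegralZl// /Rintegral.
by have := eps_mean (n%:Z - m%:Z)%R; rewrite unlock => ->; rewrite mulr0.
Qed.

Variable Xc : nat -> int -> T -> R.
Hypothesis Xc_cond : forall (n : nat) (j : int),
  is_cond_expectation P (past_sigma_algebra (fun i => eps i : T -> R) j)
    (X n) (Xc n j).

(** A version of E(X_n | F_0) is integrable and has the same integral as X_n
    over the whole space; hence that of X_n is finite. *)
Lemma X_integrable n : P.-integrable setT (EFin \o X n).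
Proof.
have [_ iXc eXc] := Xc_cond n 0.
apply: integrable_of_integral_fin => //.
rewrite -eXc; first exact: integrable_fin_num.
by have := @measurableT _ (g_sigma_algebraType (pastF 0)).
Qed.

Lemma tail_integrable n m :
  P.-integrable setT (EFin \o (tailX n m)).
Proof.
apply: (@integrable_ae_eq _ _ _ _
  (fun t => (X n t)%:E - (head_sum a m (innovations n t))%:E)).
- apply/measurable_EFinP.
  exact: (measurable_fun_of_sub (@mF _) (@tail_past n m)).
- by apply: filterS (X_decomp n) => t /(_ m) ->; rewrite -EFinB addrK.
- by apply: integrableB => //; [exact: X_integrable|exact: head_integrable].
Qed.

(** The recent innovations are centered and independent of the past: they
    integrate to 0 over past events, so the tail has the integrals that
    characterize the conditional expectation of X_n. *)
Lemma Xc_tail n m (j : int) : j = (n%:Z - m%:Z)%R ->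
  {ae P, forall t, Xc n j t = tail_sum a m (innovations n t)}.
Proof.
move=> jE; have [sXc iXc eXc] := Xc_cond n j.
apply: (@sub_measurable_ae_eq _ _ _ _ (pastF j)) => //.
- exact/sub_measurableP.
- rewrite jE; exact: tail_past.
- exact: tail_integrable.
move=> A sA; rewrite eXc//; have mA := mF sA.
have iX := X_integrable n; have it := tail_integrable n m.
have ih := head_integrable n m.
have i1 (f : T -> R) :
    P.-integrable setT (EFin \o f) -> P.-integrable A (EFin \o f).
  by apply: integrableS.
transitivity (\int[P]_(t in A) ((tail_sum a m (innovations n t))%:E +
    (head_sum a m (innovations n t))%:E)).
  apply: ae_eq_integral => //.
  - by apply: measurable_funTS; case/integrableP: iX.
  - apply: measurable_funTS; apply: emeasurable_funD.
      by case/integrableP: it.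
    by case/integrableP: ih.
  - by apply: filterS (X_decomp n) => t /(_ m) h _ /=; rewrite h EFinD.
rewrite integralD//; [|exact: i1|exact: i1].
have indE : (fun t => (head_sum a m (innovations n t))%:E) \_ A =
    EFin \o (fun t => (\1_A t * head_sum a m (innovations n t))%R).
  apply/funext => t; rewrite patchE /= indicE.
  by case: (t \in A); rewrite ?mul1r ?mul0r.
have iA : P.-integrable setT
    (EFin \o (fun t => (\1_A t * head_sum a m (innovations n t))%R)).
  by rewrite -indE -integrable_mkcond//; exact: i1.
rewrite [X in _ + X](_ : _ = 0) ?adde0// integral_mkcond indE.
rewrite -[LHS]fineK; last exact: integrable_fin_num.
have sA1 : sub_measurable (pastF j) (\1_A : T -> R).
  exact: (@measurable_indic _ (g_sigma_algebraType (pastF j))).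
have := @indep_expectM _ _ _ P _ _ me eps_indep (past j) (future j)
  (\1_A : T -> R) (headX n m) (past_future j) sA1.
rewrite {1}jE => /(_ (@head_future n m)); rewrite /Rintegral /= => -> //.
- by have := head_mean0 n m; rewrite /Rintegral => ->; rewrite mulr0.
- by apply: Lfun2_integrable; exact: indic_Lfun2.
Qed.

Variable K : R -> R.
Hypothesis K_meas : measurable_fun setT K.
Hypothesis K_sq : forall n, 'E_P[fun t => (K (X n t) ^+ 2)%R] < +oo.

Let KX n t := K (X n t).

Let mhead n m : measurable_fun setT (headX n m).
Proof. exact: (measurable_fun_of_sub (@mF _) (@head_future n m)). Qed.

Let mtail n m : measurable_fun setT (tailX n m).
Proof. exact: (measurable_fun_of_sub (@mF _) (@tail_past n m)). Qed.

Lemma KX_Lfun2 n : KX n \in Lfun P 2%:E.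
Proof.
apply/Lfun2P; first exact: measurableT_comp.
by have := K_sq n; rewrite unlock.
Qed.

Definition smoothed m w : \bar R := average P (headX m m) K w.

(** The remainder has the same law at every time. *)
Lemma smoothedE n m w :
  smoothed m w = average P (headX n m) K w.
Proof.
apply: (@innovations_law m n (fun v => (K (w + head_sum a m v)%R)%:E)).
apply/measurable_EFinP; apply: measurableT_comp => //; apply: measurable_funD.
  exact: measurable_cst.
exact: measurable_head_seq.
Qed.

Lemma smoothed_transformE m w :
  smoothed_transform P K (fun n => X n : T -> R) Xc m w = smoothed m w.
Proof.
rewrite /smoothed_transform unlock /smoothed /average.
have mXc : measurable_fun setT (Xc m 0).
  have [sXc _ _] := Xc_cond m 0.
  apply: (measurable_fun_of_sub (@mF (past 0))).
  exact/sub_measurableP.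
apply: ae_eq_integral => //.
- apply/measurable_EFinP; apply: measurableT_comp => //.
  by apply: measurable_funB => //; exact: measurable_funD.
- apply/measurable_EFinP; apply: measurableT_comp => //.
  exact: measurable_funD.
have h : (0 = m%:Z - m%:Z :> int)%R by rewrite subrr.
apply: filterS2 (X_decomp m) (Xc_tail h) => t /(_ m) -> -> _ /=.
by congr (K _)%:E; rewrite -addrA; congr (_ + _)%R; rewrite addrC addKr.
Qed.

Lemma measurable_smoothed m : measurable_fun setT (smoothed m).
Proof. exact: measurable_average. Qed.

Let g m w : R := fine (smoothed m w).

Let mg m : measurable_fun setT (g m).
Proof. by apply: measurableT_comp => //; exact: measurable_smoothed. Qed.

(** [condK n m] is K_m(X_{n,n-m}), a version of E(K(X_n) | F_{n-m}), and
    [frozenK n m] is K_m(X_{n,n-m-1}). *)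
Let condK n m t := g m (tail_sum a m (innovations n t)).
Let frozenK n m t := g m (tail_sum a m.+1 (innovations n t)).

Let tail_head_indep n m A B :
  <<s pastF (n%:Z - m%:Z)%R >> A -> measurable B ->
  P (A `&` (headX n m) @^-1` B) =
  P A * P ((headX n m) @^-1` B).
Proof.
move=> sA mB.
apply: (indep_sigma_gens me eps_indep (past_future (n%:Z - m%:Z)%R)) => //.
exact: ((sub_measurableP _ _).1 (@head_future n m)).
Qed.

Let KX_ae n m : {ae P, forall t, KX n t =
   K (tail_sum a m (innovations n t) + head_sum a m (innovations n t))%R}.
Proof. by apply: filterS (X_decomp n) => t /(_ m) h; rewrite /KX h. Qed.

Let mKth n m : measurable_fun setT
  (fun t =>
    K (tail_sum a m (innovations n t) + head_sum a m (innovations n t))%R).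
Proof. by apply: measurableT_comp => //; exact: measurable_funD. Qed.

Let LKth n m :
  (fun t =>
    K (tail_sum a m (innovations n t) + head_sum a m (innovations n t))%R)
    \in Lfun P 2%:E.
Proof. exact: Lfun2_ae_eq (@mKth n m) (KX_ae n m) (KX_Lfun2 n). Qed.

Let condKE n m t : condK n m t =
  fine (average P (headX n m) K (tail_sum a m (innovations n t))).
Proof. by rewrite /condK /g (smoothedE n). Qed.

Lemma condK_Lfun2 n m : condK n m \in Lfun P 2%:E.
Proof.
rewrite (funext (@condKE n m)).
exact: average_Lfun2 (@mF _) (@tail_past n m) (@mhead n m)
  (@tail_head_indep n m) K_meas (@LKth n m).
Qed.

Lemma condK_past n m : sub_measurable (pastF (n%:Z - m%:Z)%R) (condK n m).
Proof. by apply: measurableT_comp => //; exact: tail_past. Qed.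

Lemma frozenK_past n m :
  sub_measurable (pastF (n%:Z - m.+1%:Z)%R) (frozenK n m).
Proof. by apply: measurableT_comp => //; exact: tail_past. Qed.

Lemma condK_spec n m (phi : T -> R) :
  sub_measurable (pastF (n%:Z - m%:Z)%R) phi -> phi \in Lfun P 2%:E ->
  (\int[P]_t (phi t * KX n t) = \int[P]_t (phi t * condK n m t))%R.
Proof.
move=> sphi Lphi; under [in RHS]eq_Rintegral do rewrite condKE.
rewrite -(average_condexp (@mF _) (@tail_past n m) (@mhead n m)
  (@tail_head_indep n m) K_meas (@LKth n m) sphi Lphi).
have mphi := Lfun_meas Lphi.
apply: Rintegral_ae_eq; [|exact: measurable_funM|].
  by apply: measurable_funM => //; exact: Lfun_meas (KX_Lfun2 n).
by apply: filterS (KX_ae n m) => t ->.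
Qed.

(** With m = 0 the remainder is the empty sum and there is nothing to
    average. *)
Lemma condK0 n : {ae P, forall t, KX n t = condK n 0 t}.
Proof.
apply: filterS (KX_ae n 0) => t ->; rewrite /condK /g /smoothed /average.
rewrite {1}/head_sum big_nil addr0.
under eq_integral do rewrite /head_sum big_nil addr0.
rewrite integral_cst// [X in _ * X](_ : _ = 1) ?mule1//.
exact: probability_setT.
Qed.

Variable C : R.
Hypothesis K_bound : forall m,
  Lnorm P 2%:E (fun t =>
    smoothed_transform P K (fun n => X n : T -> R) Xc m (Xc m.+1 1%R t)
    - smoothed_transform P K (fun n => X n : T -> R) Xc m (Xc m.+1 0%R t))
  <= (C * `|a m|)%:E.

(** The function that gives [condK n m - frozenK n m] when applied to
    [innovations n]. *)
Let jump m (v : seqType R) : R :=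
  (g m (tail_sum a m v) - g m (tail_sum a m.+1 v))%R.

Let mjump m : measurable_fun setT (jump m).
Proof.
apply: measurable_funB; apply: measurableT_comp => //;
  exact: measurable_tail_seq.
Qed.

Let minnovations n : measurable_fun setT (innovations n) :=
  measurable_innovations n.

Let mjumpn n m : measurable_fun setT (fun t => jump m (innovations n t)).
Proof. exact: measurableT_comp. Qed.

Let D m t : \bar R :=
  smoothed m (tail_sum a m (innovations m.+1 t)) -
  smoothed m (tail_sum a m.+1 (innovations m.+1 t)).

Let mD m : measurable_fun setT (D m).
Proof.
by apply: emeasurable_funB;
  (apply: measurableT_comp; first exact: measurable_smoothed).
Qed.

Let mD2 m : measurable_fun setT (fun t => `|D m t| `^ 2%R).
Proof.
apply: (measurableT_comp (measurable_poweR 2%R)).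
exact: measurableT_comp.
Qed.

Let mXc n j : measurable_fun setT (Xc n j).
Proof.
have [sXc _ _] := Xc_cond n j.
apply: (measurable_fun_of_sub (@mF (past j))).
exact/sub_measurableP.
Qed.

Let D_bound m : \int[P]_t (`|D m t| `^ 2%R) <= ((C * `|a m|) ^+ 2)%:E.
Proof.
pose D' t := smoothed m (Xc m.+1 1%R t) - smoothed m (Xc m.+1 0%R t).
have mD' : measurable_fun setT D'.
  by apply: emeasurable_funB; apply: measurableT_comp => //;
    exact: measurable_smoothed.
have -> : \int[P]_t (`|D m t| `^ 2%R) = \int[P]_t (`|D' t| `^ 2%R).
  apply: ae_eq_integral => //.
    apply: (measurableT_comp (measurable_poweR 2%R)).
    exact: measurableT_comp.
  have h1 : (1 = m.+1%:Z - m%:Z :> int)%R by lia.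
  have h0 : (0 = m.+1%:Z - m.+1%:Z :> int)%R by lia.
  apply: filterS2 (Xc_tail h1) (Xc_tail h0) => t e1 e0 _.
  by rewrite /D /D' e1 e0.
rewrite -poweR_Lnorm//.
have := K_bound m; under eq_fun do rewrite !smoothed_transformE.
rewrite -/D' => le; have Ca := le_trans (Lnorm_ge0 _ _ _) le.
rewrite -powR_mulrn// -poweR_EFin.
by apply: gt0_ler_poweR; rewrite ?in_itv/= ?leey ?andbT//; exact: Lnorm_ge0.
Qed.

(** Nothing says beforehand that K_m is finite at X_{m+1,0}.  But a difference
    of extended reals is finite only if both terms are, and here its square
    has a finite integral. *)
Let D_fin m : {ae P, forall t, D m t = (jump m (innovations m.+1 t))%:E}.
Proof.
have iD : P.-integrable setT (fun t => `|D m t| `^ 2%R).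
  apply/integrableP; split => //.
  under eq_integral do rewrite gee0_abs ?poweR_ge0//.
  exact: le_lt_trans (D_bound m) (ltry _).
apply: filterS (integrable_ae measurableT iD) => t /(_ Logic.I) fin.
have : D m t \is a fin_num.
  rewrite -abse_fin_num ge0_fin_numE//; apply: (@lty_poweRy _ _ 2%R) => //.
  by rewrite -ge0_fin_numE ?poweR_ge0.
rewrite /D fin_numB => /andP[f1 f2].
by rewrite -(fineK f1) -(fineK f2) -EFinB.
Qed.

Let jump_bound n m :
  \int[P]_t (jump m (innovations n t) ^+ 2)%:E <= ((C * `|a m|) ^+ 2)%:E.
Proof.
rewrite (innovations_law n m.+1 (f := fun v => (jump m v ^+ 2)%:E)); last first.
  by apply/measurable_EFinP; exact: measurable_funX.
apply: le_trans (D_bound m); rewrite le_eqVlt; apply/orP; left; apply/eqP.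
apply: ae_eq_integral => //.
- by apply/measurable_EFinP; exact: measurable_funX.
by apply: filterS (D_fin m) => t -> _; rewrite sqr_poweR.
Qed.

Lemma jump_Lfun2 n m : (fun t => condK n m t - frozenK n m t)%R \in Lfun P 2%:E.
Proof.
apply/Lfun2P; first exact: (@mjumpn n m).
exact: le_lt_trans (jump_bound n m) (ltry _).
Qed.

Lemma frozenK_Lfun2 n m : frozenK n m \in Lfun P 2%:E.
Proof.
have := Lfun2B (condK_Lfun2 n m) (jump_Lfun2 n m).
by under eq_fun do rewrite subKr.
Qed.

Lemma jump_l2norm n m :
  (l2norm P (fun t => condK n m t - frozenK n m t)%R <= C * `|a m|)%R.
Proof.
have Ca : (0 <= C * `|a m|)%R.
  by rewrite -lee_fin; apply: le_trans (K_bound m); exact: Lnorm_ge0.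
rewrite /l2norm -[leRHS]ger0_norm// -sqrtr_sqr; apply: ler_wsqrtr.
rewrite -lee_fin /Rintegral fineK; first exact: jump_bound.
exact: integrable_fin_num (Lfun2_integrable_sqr (jump_Lfun2 n m)).
Qed.

Local Open Scope ring_scope.

(** Tower property: against a function of the older past, [condK n m] and
    [condK n m.+1] integrate like K(X_n). *)
Lemma condK_diff_orth n m (phi : T -> R) :
  sub_measurable (pastF (n%:Z - m.+1%:Z)) phi -> phi \in Lfun P 2%:E ->
  \int[P]_t (phi t * (condK n m t - condK n m.+1 t)) = 0.
Proof.
move=> sphi Lphi.
have sphi' : sub_measurable (pastF (n%:Z - m%:Z)) phi.
  by apply: sub_measurableW sphi; apply: sigma_gensS; apply: pastS; lia.
rewrite l2_ipBr//; try exact: condK_Lfun2.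
by rewrite -!condK_spec// subrr.
Qed.

Let LD n m : (fun t => condK n m t - condK n m.+1 t) \in Lfun P 2%:E.
Proof. by apply: Lfun2B; exact: condK_Lfun2. Qed.

(** The two differences differ by [frozenK n m - condK n m.+1], which is a
    function of the older past and so is orthogonal to the increment. *)
Lemma condK_diff_l2norm n m :
  l2norm P (fun t => condK n m t - condK n m.+1 t) <= C * `|a m|.
Proof.
apply: le_trans (jump_l2norm n m).
apply: l2norm_le_of_ip; [exact: LD|exact: jump_Lfun2|].
have sphi : sub_measurable (pastF (n%:Z - m.+1%:Z))
    (fun t => condK n m.+1 t - frozenK n m t).
  by apply: measurable_funB; [exact: condK_past|exact: frozenK_past].
have := @condK_diff_orth n m _ sphi
  (Lfun2B (condK_Lfun2 n m.+1) (frozenK_Lfun2 n m)).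
rewrite l2_ipC => o; apply/eqP.
rewrite -subr_eq0 -oppr_eq0 opprB -{}o; apply/eqP.
rewrite -l2_ipBr; [|exact: LD|exact: jump_Lfun2|exact: LD].
apply: eq_Rintegral => t _; congr (_ * _).
by rewrite opprB addrC addrA subrK.
Qed.

(** The hypothesis puts both martingales at the same time.  The difference of
    the inner products is the inner product of the increments, and the second
    increment may be replaced by [condK n' m' - frozenK n' m'], since they
    differ by a function of the older past. *)
Lemma condK_ip_step n n' m m' : n%:Z - m%:Z = n'%:Z - m'%:Z :> int ->
  `|\int[P]_t (condK n m t * condK n' m' t) -
    \int[P]_t (condK n m.+1 t * condK n' m'.+1 t)| <=
  (C * `|a m|) * (C * `|a m'|).
Proof.
move=> nm.
have nm1 : n%:Z - m.+1%:Z = n'%:Z - m'.+1%:Z :> int by lia.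
have L := condK_Lfun2.
have e1 : \int[P]_t ((condK n m t - condK n m.+1 t) * frozenK n' m' t) = 0.
  rewrite l2_ipC; apply: condK_diff_orth; last exact: frozenK_Lfun2.
  by rewrite nm1; exact: frozenK_past.
have e2 : \int[P]_t (condK n m.+1 t * (condK n' m' t - condK n' m'.+1 t)) = 0.
  by apply: condK_diff_orth => //; rewrite -nm1; exact: condK_past.
have -> : \int[P]_t (condK n m t * condK n' m' t) -
    \int[P]_t (condK n m.+1 t * condK n' m'.+1 t) =
    \int[P]_t ((condK n m t - condK n m.+1 t) *
      (condK n' m' t - frozenK n' m' t)).
  rewrite [RHS](l2_ipBr (LD n m) (L n' m') (frozenK_Lfun2 n' m')) e1 subr0.
  rewrite [RHS](l2_ipBl (L n m) (L n m.+1) (L n' m')).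
  move: e2; rewrite (l2_ipBr (L n m.+1) (L n' m') (L n' m'.+1)) => /eqP.
  by rewrite subr_eq0 => /eqP ->.
apply: (le_trans (cauchy_schwarz (LD n m) (jump_Lfun2 n' m'))).
apply: ler_pM; rewrite ?l2norm_ge0//; first exact: condK_diff_l2norm.
exact: jump_l2norm.
Qed.

Let L1 : (cst 1 : T -> R) \in Lfun P 2%:E := Lfun_cst P 1 2.

Lemma condK_mean n m : \int[P]_t condK n m t = \int[P]_t KX n t.
Proof.
have s1 : sub_measurable (pastF (n%:Z - m%:Z)) (cst 1 : T -> R).
  exact: (@sub_measurable_cst _ T R _ 1).
have := condK_spec s1 L1.
under eq_Rintegral do rewrite mul1r.
by under [in RHS]eq_Rintegral do rewrite mul1r.
Qed.

(** Once centered, [condK n k] is bounded by K(X_n) in quadratic mean and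
    depends on innovations that recede to -oo with k. *)
Lemma condK_mixing n n' :
  \int[P]_t (condK n k t * KX n' t) @[k --> \oo] -->
  (\int[P]_t KX n t) * (\int[P]_t KX n' t).
Proof.
set mu := \int[P]_t KX n t.
pose W k t := condK n k t - mu.
have Lmu : (cst mu : T -> R) \in Lfun P 2%:E := Lfun_cst P mu 2.
have LW k : W k \in Lfun P 2%:E by exact: Lfun2B (condK_Lfun2 n k) Lmu.
have sW k : sub_measurable (pastF (n%:Z - k%:Z)) (W k).
  apply: measurable_funB; first exact: condK_past.
  exact: (@sub_measurable_cst _ T R _ mu).
have W0 k : \int[P]_t W k t = 0.
  rewrite RintegralB//; [|exact: Lfun2_integrable (condK_Lfun2 n k)|
    exact: Lfun2_integrable Lmu].
  by rewrite condK_mean Rintegral_cst// [X in fine X](_ : _ = 1%E)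
    ?mulr1 ?subrr//; exact: probability_setT.
have Wc k : l2norm P (W k) <= l2norm P (KX n).
  apply: l2norm_le_of_ip => //; first exact: KX_Lfun2.
  rewrite (condK_spec (@sW k) (LW k)) l2_ipBr//; last exact: condK_Lfun2.
  by rewrite RintegralZr ?W0 ?mul0r ?subr0//; exact: Lfun2_integrable.
have van i : exists N, forall k, (N <= k)%N -> ~ past (n%:Z - k%:Z) i.
  by exists (n + `|i|).+1%N => k; rewrite /past /=; lia.
have sZ : sub_measurable (cylinder e setT) (condK n' 0).
  apply: sub_measurableW (@condK_past n' 0).
  apply: subset_trans (@sigma_gens_cylinder _ _ _ _ _).
  by apply: sigma_gensS.
have := mixing me eps_indep van sW LW W0 Wc (condK_Lfun2 n' 0) sZ.
move=> cvW; rewrite -[X in _ --> X]add0r.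
rewrite (_ : (fun k => _) = (fun k => \int[P]_t (W k t * condK n' 0 t)) \+
    cst (mu * \int[P]_t KX n' t)).
  by apply: cvgD => //; exact: cvg_cst.
apply/funext => k /=.
have -> : \int[P]_t (W k t * condK n' 0 t) = \int[P]_t (W k t * KX n' t).
  apply: Rintegral_ae_eq.
  - apply: measurable_funM; first exact: Lfun_meas (LW k).
    exact: Lfun_meas (condK_Lfun2 n' 0).
  - apply: measurable_funM; first exact: Lfun_meas (LW k).
    exact: Lfun_meas (KX_Lfun2 n').
  - by apply: filterS (condK0 n') => t ->.
rewrite /W l2_ipBl; [|exact: condK_Lfun2|exact: Lmu|exact: KX_Lfun2].
rewrite RintegralZl ?subrK//; exact: Lfun2_integrable (KX_Lfun2 n').
Qed.

Let psi (v : seqType R) : R := g 0 (tail_sum a 0 v).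

Let mpsi : measurable_fun setT psi.
Proof. by apply: measurableT_comp => //; exact: measurable_tail_seq. Qed.

Lemma KX_mean_stationary m n : 'E_P[KX m] = 'E_P[KX n].
Proof.
rewrite unlock.
have law k : (\int[P]_t (KX k t)%:E = \int[P]_t (psi (innovations k t))%:E)%E.
  apply: ae_eq_integral => //.
  - by apply/measurable_EFinP; exact: Lfun_meas (KX_Lfun2 k).
  - by apply/measurable_EFinP; exact: measurableT_comp.
  - by apply: filterS (condK0 k) => t kt _; congr EFin.
rewrite !law; apply: (@innovations_law _ _ (fun v => (psi v)%:E)).
exact/measurable_EFinP.
Qed.

(** X_m is the same function of the sequence of innovations at time m + h,
    shifted by h, as X_{m+h} is of the sequence itself. *)
Lemma KX_prod_stationary m n h :
  'E_P[KX m * KX (m + h)%N] = 'E_P[KX n * KX (n + h)%N].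
Proof.
rewrite unlock.
pose f (v : seqType R) := (psi (fun i => v (i + h)%N) * psi v)%:E.
have msh : measurable_fun setT
    (fun v : seqType R => (fun i => v (i + h)%N) : seqType R).
  by apply: (@measurable_seqP R _ (seqType R)) => i; exact: measurable_coord.
have mf : measurable_fun setT f.
  apply/measurable_EFinP.
  exact: (measurable_funM (measurableT_comp mpsi msh) mpsi).
have shiftE k t :
    (fun i => innovations (k + h)%N t (i + h)%N) = innovations k t :> seqType R.
  by apply/funext => i; rewrite /innovations; congr (eps _ t); lia.
have law k : (\int[P]_t (KX k t * KX (k + h)%N t)%:E =
    \int[P]_t f (innovations (k + h)%N t))%E.
  apply: ae_eq_integral => //.
  - apply/measurable_EFinP; apply: measurable_funM.
      exact: Lfun_meas (KX_Lfun2 k).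
    exact: Lfun_meas (KX_Lfun2 (k + h)%N).
  - exact: measurableT_comp.
  apply: filterS2 (condK0 k) (condK0 (k + h)%N) => t kt kht _.
  transitivity (condK k 0 t * condK (k + h)%N 0 t)%:E.
    by rewrite -kt -kht.
  by rewrite /f shiftE.
by rewrite !law; exact: innovations_law.
Qed.

Let KX1 n : KX n \in Lfun P 1.
Proof. by apply/Lfun1_integrable; exact: Lfun2_integrable (KX_Lfun2 n). Qed.

Let KXM n n' : KX n * KX n' \in Lfun P 1.
Proof. by apply: Lfun2_mul_Lfun1; exact: KX_Lfun2. Qed.

Lemma KX_covariance_stationary : covariance_stationary P KX.
Proof.
split.
- by move=> n; exact: Lfun_meas (KX_Lfun2 n).
- exact: K_sq.
- exact: KX_mean_stationary.
- move=> m n h; rewrite !covarianceE//.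
  rewrite (KX_prod_stationary m n h) (KX_mean_stationary m n).
  by rewrite (KX_mean_stationary (m + h)%N (n + h)%N).
Qed.

Lemma KX_covE n n' : covariance P (KX n) (KX n') =
  (\int[P]_t (condK n 0 t * KX n' t) -
   (\int[P]_t KX n t) * (\int[P]_t KX n' t))%:E.
Proof.
rewrite covarianceE// EFinB EFinM /Rintegral.
rewrite !fineK; try (apply: integrable_fin_num => //;
  by [exact: Lfun2_integrable (KX_Lfun2 _)|
      exact: mul_integrable (condK_Lfun2 _ _) (KX_Lfun2 _)]).
rewrite unlock; congr (_ - _)%E.
apply: ae_eq_integral => //.
- by apply/measurable_EFinP; apply: measurable_funM;
    [exact: Lfun_meas (KX_Lfun2 n)|exact: Lfun_meas (KX_Lfun2 n')].
- by apply/measurable_EFinP; apply: measurable_funM;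
    [exact: Lfun_meas (condK_Lfun2 n 0)|exact: Lfun_meas (KX_Lfun2 n')].
by apply: filterS (condK0 n) => t nt _; congr EFin; rewrite -nt.
Qed.

Hypothesis a_summable : cvgn [normed series a].
Hypothesis C_ge0 : 0 <= C.

(** At lag h, the martingales of K(X_1) and K(X_{h+1}) are at the same time
    after k and h + k steps backwards. *)
Lemma KX_cov_sum_le H :
  \sum_(0 <= h < H) `|\int[P]_t (condK 1 0 t * KX h.+1 t) -
     (\int[P]_t KX 1 t) * (\int[P]_t KX h.+1 t)|
  <= (C * limn [normed series a]) ^+ 2.
Proof.
pose b h k := \int[P]_t (condK 1 k t * condK h.+1 (h + k)%N t).
have bE h k : b h k = \int[P]_t (condK 1 k t * KX h.+1 t).
  rewrite /b (@condK_spec h.+1 (h + k) (condK 1 k)) ?condK_Lfun2//.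
  rewrite (_ : h.+1%:Z - (h + k)%:Z = 1%N%:Z - k%:Z); last by lia.
  exact: condK_past.
under eq_bigr do rewrite -bE.
apply: (telescoping_bound (b := b) (c := fun k => C * `|a k|)).
- move=> h k; rewrite /b addnS; apply: condK_ip_step; lia.
- move=> h; rewrite (funext (bE h)); exact: condK_mixing.
- by move=> k; exact: mulr_ge0.
move=> N; rewrite -mulr_sumr ler_wpM2l//.
apply: (nondecreasing_cvgn_le _ a_summable N).
by apply: nondecreasing_series => k _ _; exact: normr_ge0.
Qed.

Lemma KX_short_memory : short_memory P KX.
Proof.
split; first exact: KX_covariance_stationary.
apply: (@le_lt_trans _ _ ((C * limn [normed series a]) ^+ 2)%:E).
  2: exact: ltry.
apply: lime_le; first by apply: is_cvg_nneseries.
apply: nearW => -[|N].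
  by rewrite big_geq// lee_fin sqr_ge0.
rewrite big_add1 /=; under eq_bigr do rewrite KX_covE abse_EFin.
by rewrite sumEFin lee_fin; exact: KX_cov_sum_le.
Qed.

End linear_process.

Theorem theorem2p3 (R : realType) (d : measure_display) (T : measurableType d)
    (P : probability T R)
    (eps : int -> {RV P >-> R})
    (eps_indep : mutually_independent P (fun i => eps i : T -> R))
    (eps_id : identically_distributed P (fun i => eps i : T -> R))
    (eps_mean : forall i, 'E_P[eps i] = 0)
    (eps_var : forall i, 'E_P[fun t => (eps i t ^+ 2)%R] = 1)
    (a : nat -> R)
    (a_summable : cvgn [normed series a])
    (X : nat -> {RV P >-> R})
    (X_linear : forall n : nat,
      {ae P, forall t,
        series (fun i : nat => (a i * eps (n%:Z - i%:Z)%R t)%R) @ \oo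
          --> (X n t : R)})
    (Xc : nat -> int -> T -> R)
    (Xc_cond : forall (n : nat) (j : int),
      is_cond_expectation P (past_sigma_algebra (fun i => eps i : T -> R) j)
        (X n) (Xc n j))
    (K : R -> R)
    (K_meas : measurable_fun setT K)
    (K_sq : forall n, 'E_P[fun t => (K (X n t) ^+ 2)%R] < +oo)
    (K_bound :
      let Kn := smoothed_transform P K (fun n => X n : T -> R) Xc in
      bounded_ratio
        (fun n => Lnorm P 2%:E (fun t => Kn n.-1 (Xc n 1%R t)
                                         - Kn n.-1 (Xc n 0%R t)))
        (fun n => `|a n.-1|%R)) :
  short_memory P (fun n t => K (X n t)).
Proof.
have [C CP] := K_bound.
apply: (@KX_short_memory _ _ _ _ eps eps_indep eps_id eps_mean a X X_linear
  Xc Xc_cond K K_meas K_sq `|C|%R) => //.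
move=> m; have := CP m.+1 isT.
rewrite gee0_abs ?Lnorm_ge0// => /le_trans; apply.
by rewrite lee_fin ler_wpM2r// ler_norm.
Qed.
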